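(* Let $M\ge 4$ and suppose $N\ge 4M-6$. Then a generic frame $\Phi=\{\varphi_i: i=1,\ldots,N\}\subset\mathbb{R}^M$ is conjugate phase retrievable; that is, the set of full-rank matrices in $\mathbb{R}^{M\times N}$ whose columns form a conjugate phase retrievable set on $\mathbb{C}^M$ is open and dense in $\mathbb{R}^{M\times N}$ and its complement has Lebesgue measure $0$.
   Context: A set of vectors $\{\varphi_n\}_{n=1}^N\subset\mathbb{C}^M$ is conjugate phase retrievable (on $\mathbb{C}^M$) if for all $x,y\in\mathbb{C}^M$: $|\langle x,\varphi_n\rangle|=|\langle y,\varphi_n\rangle|$ for all $n$ implies that there is $\theta\in\mathbb{R}$ with $x=e^{i\theta}y$ or $x=e^{i\theta}\overline{y}$, where $\overline{y}$ is the coordinatewise conjugate. A frame of $N$ real vectors is identified with the full-rank (rank $M$) matrix $\Phi\in\mathbb{R}^{M\times N}$ having these vectors as columns. ''A generic frame has property $\mathcal{P}$'' means: the set $Y$ of full-rank matrices in $\mathbb{R}^{M\times N}$ with property $\mathcal{P}$ is open and dense in $\mathbb{R}^{M\times N}$ (Euclidean topology) and $Y^c$ has Lebesgue measure $0$. *)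

(* Defs.v *)
From HB Require Import structures.
From mathcomp Require Import all_boot all_order all_algebra.
From mathcomp Require Import all_classical all_reals all_analysis.
From mathcomp.real_closed Require Import complex.

Set Implicit Arguments.
Unset Strict Implicit.
Unset Printing Implicit Defensive.

Import Order.TTheory GRing.Theory Num.Theory.
Import numFieldNormedType.Exports.

Local Open Scope classical_set_scope.
Local Open Scope ring_scope.
Local Open Scope complex_scope.

Section ConjugatePhaseRetrieval.
Variables (R : realType) (M N : nat).

(* Linear in the first argument, conjugate-linear in the second. *)
Definition cinner (x y : 'cV[R[i]]_M) : R[i] :=
  \sum_(j < M) x j 0 * Num.conj (y j 0).

Definition cconj (y : 'cV[R[i]]_M) : 'cV[R[i]]_M := map_mx Num.conj y.

(* e^(i theta), by Euler's formula. *)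
Definition expi (theta : R) : R[i] := cos theta +i* sin theta.

Definition conj_phase_retrievable (phi : 'I_N -> 'cV[R[i]]_M) : Prop :=
  forall x y : 'cV[R[i]]_M,
    (forall n, `|cinner x (phi n)| = `|cinner y (phi n)|) ->
    exists theta : R, x = expi theta *: y \/ x = expi theta *: cconj y.

Definition complex_columns (Phi : 'M[R]_(M, N)) : 'I_N -> 'cV[R[i]]_M :=
  fun n => map_mx (real_complex R) (col n Phi).

End ConjugatePhaseRetrieval.

Section Lebesgue.
Variables (R : realType) (m n : nat).

Definition mx_box (a b : 'M[R]_(m, n)) : set 'M[R]_(m, n) :=
  [set A | forall i j, a i j <= A i j <= b i j].

(* The maximum with 0 gives volume 0 to the empty boxes. *)
Definition mx_box_volume (a b : 'M[R]_(m, n)) : R :=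
  \prod_(i < m) \prod_(j < n) Num.max 0 (b i j - a i j).

(* Lebesgue outer measure on R^(m x n): the infimum of the total volumes of
   the countable covers by boxes.  It agrees with Lebesgue measure on
   measurable sets, and the Lebesgue null sets are those where it is 0. *)
Definition mx_lebesgue (A : set 'M[R]_(m, n)) : \bar R :=
  ereal_inf [set v | exists a b : nat -> 'M[R]_(m, n),
    A `<=` \bigcup_k mx_box (a k) (b k) /\
    v = (\sum_(0 <= k <oo) (mx_box_volume (a k) (b k))%:E)%E].

End Lebesgue.

(* A frame is a full-rank matrix, so Y also imposes the rank condition, and
   its complement is taken in the space of all M x N matrices. *)
Definition generic_frame (R : realType) (M N : nat)
    (P : 'M[R]_(M, N) -> Prop) : Prop :=
  let Y := [set Phi : 'M[R]_(M, N) | \rank Phi = M /\ P Phi] in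
  [/\ open Y, dense Y & mx_lebesgue (~` Y) = 0%E].

(* Main.v *)
Require Import Defs.
From HB Require Import structures.
From mathcomp Require Import all_boot all_order all_algebra.
From mathcomp Require Import all_classical all_reals all_analysis.
From mathcomp.real_closed Require Import complex.
From mathcomp Require Import ring lra zify.

(** For x = a + i b with a, b real, the measurement |<x, phi>|^2 by a real
    vector phi is the value at phi of the quadratic form G_x = a a^T + b b^T,
    and G_x = G_y exactly when x is y or its conjugate up to a phase
    ([re_gram_inj]).  So Phi is conjugate phase retrievable iff no nonzero
    difference G_x - G_y vanishes on all the columns of Phi
    ([conj_phase_retrievableP]).  Such a Phi has full rank, since otherwise x
    could be taken in the left kernel of Phi and y = 0.

    Genericity is a dimension count.  A difference G_x - G_y is symmetric of
    rank at most 4.  Symmetric matrices of rank at most 4 depend on 4M - 6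
    parameters, hence on 4M - 7 up to scaling, and the N equations on the
    columns cost one dimension each: the bad Phi have dimension at most
    4M - 7 + N(M - 1) < NM.  The count is carried out with transcendence
    degrees rather than with manifolds: if the entries of Phi are
    algebraically independent over the rationals and Phi were bad, these NM
    numbers would all be algebraic over 4M - 7 parameters of the form and
    M - 1 entries of each column, which contradicts the exchange property of
    algebraic closure ([indep_no_low_rank_form]).

    It remains to see that matrices with algebraically independent entries
    are dense and that the others are Lebesgue null, and that the good set is
    open.
    - Density: the numbers algebraic over finitely many reals are countable,
      so the entries can be chosen one at a time close to prescribed values.
    - Nullity: matrices with dependent entries are covered by countably many
      sets where an integer polynomial q vanishes but one partial derivative
      of q does not.  Near each of its points such a set is a Lipschitz graph
      over the other coordinates, and a grid of small boxes shows that a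
      Lipschitz graph is null ([mx_lebesgue_lipschitz_graph]).
    - Openness: after scaling, the forms range over a compact sphere, so it is
      enough that the differences G_x - G_y form a closed set.  By splitting
      off squares one at a time, a symmetric Q fails to be such a difference
      only if Q or - Q is an inner product on some three-dimensional space
      ([gram_differenceP]), and this persists under small perturbations while
      excluding differences ([not_gram_difference_near]). *)

Set Implicit Arguments.
Unset Strict Implicit.
Unset Printing Implicit Defensive.

Import Order.TTheory GRing.Theory Num.Theory.
Import numFieldNormedType.Exports.

Local Open Scope classical_set_scope.
Local Open Scope ring_scope.

(** * Integer polynomial expressions and algebraic dependence *)

(** Integer polynomials as syntax rather than as a quotient: countability,
    evaluation in any commutative ring and formal partial derivatives are then
    all structural. *)
Inductive pexpr : Type :=
  | PVar of nat
  | PInt of int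
  | PAdd of pexpr & pexpr
  | PMul of pexpr & pexpr.

Fixpoint pexpr_encode (e : pexpr) : GenTree.tree (nat + int) :=
  match e with
  | PVar i => GenTree.Leaf (inl i)
  | PInt c => GenTree.Leaf (inr c)
  | PAdd e1 e2 => GenTree.Node 0 [:: pexpr_encode e1; pexpr_encode e2]
  | PMul e1 e2 => GenTree.Node 1 [:: pexpr_encode e1; pexpr_encode e2]
  end.

Fixpoint pexpr_decode (t : GenTree.tree (nat + int)) : option pexpr :=
  match t with
  | GenTree.Leaf (inl i) => Some (PVar i)
  | GenTree.Leaf (inr c) => Some (PInt c)
  | GenTree.Node k [:: t1; t2] =>
      if pexpr_decode t1 is Some e1 then
        if pexpr_decode t2 is Some e2 then
          Some (if k is 0%N then PAdd e1 e2 else PMul e1 e2)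
        else None
      else None
  | _ => None
  end.

Lemma pexpr_encodeK : pcancel pexpr_encode pexpr_decode.
Proof. by elim=> //= e1 -> e2 ->. Qed.

HB.instance Definition _ := Countable.copy pexpr (pcan_type pexpr_encodeK).

Fixpoint peval (A : comNzRingType) (v : nat -> A) (e : pexpr) : A :=
  match e with
  | PVar i => v i
  | PInt c => c%:~R
  | PAdd e1 e2 => peval v e1 + peval v e2
  | PMul e1 e2 => peval v e1 * peval v e2
  end.

Lemma peval_morph (A B : comNzRingType) (f : {rmorphism A -> B}) v e :
  f (peval v e) = peval (f \o v) e.
Proof.
elim: e => [i|c|e1 IH1 e2 IH2|e1 IH1 e2 IH2] //=.
- by rewrite rmorph_int.
- by rewrite rmorphD IH1 IH2.
- by rewrite rmorphM IH1 IH2.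
Qed.

Lemma eq_peval (A : comNzRingType) (v w : nat -> A) e :
  v =1 w -> peval v e = peval w e.
Proof. by move=> vw; elim: e => //= e1 -> e2 ->. Qed.

Section AlgebraicSpan.
Variable F : fieldType.
Implicit Types (S T : seq F) (a b c : F) (p : {poly F}).

Definition ring_span S : {pred F} :=
  fun c => `[< exists e, c = peval (nth 0 S) e >].

Lemma ring_spanP S c :
  reflect (exists e, c = peval (nth 0 S) e) (c \in ring_span S).
Proof. exact: asboolP. Qed.

Lemma ring_span_subring S : subring_closed (ring_span S).
Proof.
split=> [|x y /ring_spanP[e ->] /ring_spanP[f ->]|
          x y /ring_spanP[e ->] /ring_spanP[f ->]].
- by apply/ring_spanP; exists (PInt 1).
- apply/ring_spanP; exists (PAdd e (PMul (PInt (-1)) f)) => /=.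
  by rewrite mulrN1z mulN1r.
- by apply/ring_spanP; exists (PMul e f).
Qed.

HB.instance Definition _ S :=
  GRing.isSubringClosed.Build F (ring_span S) (ring_span_subring S).

Lemma mem_ring_span S : {subset S <= ring_span S}.
Proof.
move=> x xS; apply/ring_spanP; exists (PVar (index x S)) => /=.
by rewrite nth_index.
Qed.

Lemma ring_span_min S (P : subringClosed F) :
  {subset S <= P} -> {subset ring_span S <= P}.
Proof.
move=> SP _ /ring_spanP[e ->].
elim: e => [i|c|e1 IH1 e2 IH2|e1 IH1 e2 IH2] /=.
- have [iS|iS] := ltnP i (size S); first exact/SP/mem_nth.
  by rewrite nth_default// rpred0.
- exact: rpred_int.
- exact: rpredD.
- exact: rpredM.
Qed.

(** The value v = 0 is harmless, because u / 0 = 0 is in the field anyway. *)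
Definition frac_span S : {pred F} :=
  fun c => `[< exists u v, [/\ u \in ring_span S, v \in ring_span S & c = u / v] >].

Lemma frac_spanP S c :
  reflect (exists u v, [/\ u \in ring_span S, v \in ring_span S & c = u / v])
          (c \in frac_span S).
Proof. exact: asboolP. Qed.

Lemma frac_span_divring S : divring_closed (frac_span S).
Proof.
split=> [|x y /frac_spanP[u [v [uS vS ->]]] /frac_spanP[u' [v' [uS' vS' ->]]]|
          x y /frac_spanP[u [v [uS vS ->]]] /frac_spanP[u' [v' [uS' vS' ->]]]].
- by apply/frac_spanP; exists 1, 1; rewrite divr1 rpred1.
- apply/frac_spanP.
  have [->|v0] := eqVneq v 0.
    exists (- u'), v'; split=> //; first by rewrite rpredN.
    by rewrite invr0 mulr0 sub0r mulNr.
  have [->|v0'] := eqVneq v' 0.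
    by exists u, v; split=> //; rewrite invr0 mulr0 subr0.
  exists (u * v' - u' * v), (v * v'); split; [by rewrite rpredB ?rpredM|exact: rpredM|].
  by field; rewrite v0 v0'.
- apply/frac_spanP; exists (u * v'), (v * u'); split; [exact: rpredM|exact: rpredM|].
  by rewrite !invfM invrK; ring.
Qed.

HB.instance Definition _ S :=
  GRing.isDivringClosed.Build F (frac_span S) (frac_span_divring S).

Section FracField.
Variable S : seq F.
(** The subfield generated by S as a type of its own, which gives access to the
    theory of elements algebraic over a field. *)
Record frac_field := FracField { frac_val : F; _ : frac_val \in frac_span S }.
HB.instance Definition _ := [isSub for frac_val].
HB.instance Definition _ := [Choice of frac_field by <:].
HB.instance Definition _ := [SubChoice_isSubUnitRing of frac_field by <:].
HB.instance Definition _ := [SubNzRing_isSubComNzRing of frac_field by <:].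
HB.instance Definition _ := [SubComUnitRing_isSubIntegralDomain of frac_field by <:].
HB.instance Definition _ := [SubIntegralDomain_isSubField of frac_field by <:].
End FracField.

(** Coefficients are taken in the ring generated by S, not in its fraction
    field: polynomial expressions are what is later differentiated and
    enumerated. *)
Definition alg_span S : {pred F} := fun a =>
  `[< exists p, [/\ p \is a polyOver (ring_span S), p != 0 & root p a] >].

Lemma alg_spanP S a :
  reflect (exists p, [/\ p \is a polyOver (ring_span S), p != 0 & root p a])
          (a \in alg_span S).
Proof. exact: asboolP. Qed.

Lemma ring_sub_frac S : {subset ring_span S <= frac_span S}.
Proof.
by move=> c cS; apply/frac_spanP; exists c, 1; rewrite divr1 rpred1.
Qed.

(** Makes algebraicity over the fraction field the same as algebraicity over
    the ring, by clearing the denominators of a polynomial. *)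
Lemma common_denominator S (s : seq F) : {subset s <= frac_span S} ->
  exists2 d, d != 0 & d \in ring_span S /\ {in s, forall c, d * c \in ring_span S}.
Proof.
elim: s => [|c s IHs] sS.
  by exists 1; rewrite ?oner_neq0//; split=> //; exact: rpred1.
have [|d d0 [dS ds]] := IHs; first by move=> x xs; apply: sS; rewrite inE xs orbT.
have /frac_spanP[u [v [uS vS cE]]] : c \in frac_span S by rewrite sS// mem_head.
have [v0|v0] := eqVneq v 0.
  exists d => //; split=> // x; rewrite inE => /predU1P[->|/ds//].
  by rewrite cE v0 invr0 !mulr0 rpred0.
exists (d * v); first by rewrite mulf_neq0.
split; first exact: rpredM.
move=> x; rewrite inE => /predU1P[->|/ds dx].
  have -> : d * v * c = d * u by rewrite cE; field.
  exact: rpredM.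
by rewrite mulrAC rpredM.
Qed.

Lemma alg_span_algebraic S a :
  a \in alg_span S <-> algebraicOver (\val : frac_field S -> F) a.
Proof.
split=> [/alg_spanP[p [pS p0 pa]]|[p p0 pa]].
  apply/integral_algebraic/(integral_root p0 pa) => c cp.
  have cS : c \in frac_span S by apply/ring_sub_frac/(allP pS).
  by have := integral_id (\val : frac_field S -> F) (FracField cS).
pose q := map_poly (\val : frac_field S -> F) p.
have [|d d0 [_ dq]] := @common_denominator S q.
  move=> _ /(nthP 0)[i _ <-]; rewrite coef_map; exact: valP.
apply/alg_spanP; exists (d *: q); split.
- apply/polyOverP => i; rewrite coefZ.
  have [iq|iq] := ltnP i (size q); first exact/dq/mem_nth.
  by rewrite nth_default// mulr0 rpred0.
- by rewrite scale_poly_eq0 negb_or d0 map_poly_eq0.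
- by rewrite rootZ.
Qed.

Lemma alg_span_divring S : divring_closed (alg_span S).
Proof.
split=> [|x y /alg_span_algebraic Sx /alg_span_algebraic Sy|
          x y /alg_span_algebraic Sx /alg_span_algebraic Sy];
  apply/alg_span_algebraic.
- exact: algebraic1.
- exact: algebraic_sub.
- exact: algebraic_div.
Qed.

HB.instance Definition _ S :=
  GRing.isDivringClosed.Build F (alg_span S) (alg_span_divring S).

Lemma alg_span_root S p a : p != 0 -> root p a ->
  p \is a polyOver (alg_span S) -> a \in alg_span S.
Proof.
move=> p0 pa pS; apply/alg_span_algebraic/integral_algebraic.
apply: integral_root p0 pa _ => c /(allP pS).
by move=> /alg_span_algebraic/integral_algebraic.
Qed.

Lemma ring_sub_alg S : {subset ring_span S <= alg_span S}.
Proof.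
move=> c cS; apply/alg_spanP; exists ('X - c%:P).
by rewrite root_XsubC polyXsubC_eq0 polyOverXsubC.
Qed.

Lemma mem_alg_span S : {subset S <= alg_span S}.
Proof. by move=> x xS; apply/ring_sub_alg/mem_ring_span. Qed.

Lemma alg_span_trans S T :
  {subset S <= alg_span T} -> {subset alg_span S <= alg_span T}.
Proof.
move=> ST a /alg_spanP[p [pS p0 pa]]; apply: alg_span_root p0 pa _.
by apply: polyOverS pS => c; exact: ring_span_min.
Qed.

Lemma alg_spanS S T : {subset S <= T} -> {subset alg_span S <= alg_span T}.
Proof. by move=> ST; apply: alg_span_trans => x /ST; exact: mem_alg_span. Qed.

Lemma ring_span_cons b S c : c \in ring_span (b :: S) ->
  exists2 f : {poly F}, f \is a polyOver (ring_span S) & c = f.[b].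
Proof.
move=> /ring_spanP[e ->].
elim: e => [[|i]|n|e1 [f1 f1S E1] e2 [f2 f2S E2]|e1 [f1 f1S E1] e2 [f2 f2S E2]] /=.
- by exists 'X; rewrite ?polyOverX// hornerX.
- exists (nth 0 S i)%:P; rewrite ?hornerC// polyOverC.
  have [iS|iS] := ltnP i (size S); first exact/mem_ring_span/mem_nth.
  by rewrite nth_default// rpred0.
- by exists (n%:~R); [exact: rpred_int|rewrite -(rmorph_int (@polyC F)) hornerC].
- by exists (f1 + f2); [exact: rpredD|rewrite hornerD E1 E2].
- by exists (f1 * f2); [exact: rpredM|rewrite hornerM E1 E2].
Qed.

Lemma horner_ring_span a S p : p \is a polyOver (ring_span S) ->
  p.[a] \in ring_span (a :: S).
Proof.
move=> pS; apply: rpred_horner; last exact/mem_ring_span/mem_head.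
apply: polyOverS pS => c; apply: ring_span_min => x xS.
by apply: mem_ring_span; rewrite inE xS orbT.
Qed.

(** The exchange property: read a polynomial relation between a and b over S
    as a polynomial in b with coefficients depending on a.  It does not become
    trivial, since one of these coefficients is a nonzero polynomial over S,
    and a is not algebraic over S. *)
Lemma alg_span_exchange S a b : a \in alg_span (b :: S) ->
  a \notin alg_span S -> b \in alg_span (a :: S).
Proof.
move=> /alg_spanP[p [pS p0 pa]] aS.
have /choice[f fP] : forall i, exists f : {poly F},
    f \is a polyOver (ring_span S) /\ p`_i = f.[b].
  by move=> i; have [f fS fb] := ring_span_cons (polyOverP pS i); exists f.
(* P(Y, X), with Y outer, lifts p to an indeterminate X in place of b. *)
pose P : {poly {poly F}} := \poly_(i < size p) f i.
have PS : P \is a polyOver (polyOver (ring_span S)).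
  by apply/polyOverP => i; rewrite coef_poly; case: ifP; rewrite ?rpred0// => _; case: (fP i).
have PE : map_poly (horner_eval b) P = p.
  apply/polyP => i; rewrite coef_map coef_poly; case: ltnP => ip.
    by case: (fP i) => _ ->.
  by rewrite raddf0 nth_default.
pose Q := swapXY P.
have Q0 : Q != 0.
  apply: contraNneq p0 => Q0; rewrite -PE.
  have -> : P = 0 by apply: (can_inj (@swapXYK F)); rewrite -/Q Q0 rmorph0.
  by rewrite rmorph0.
have QS i : Q`_i \is a polyOver (ring_span S).
  by apply/polyOverP => j; rewrite coef_swapXY; apply/polyOverP/(polyOverP PS).
pose q := map_poly (horner_eval a) Q.
apply/alg_spanP; exists q; split.
- by apply/polyOverP => i; rewrite coef_map; exact: horner_ring_span.
(* q = 0 would make a a root of every coefficient of Q *)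
- apply: contraNneq aS => q0; apply/alg_spanP; exists (lead_coef Q).
  rewrite lead_coef_eq0; split=> //; first exact: QS.
  have := congr1 (fun r : {poly F} => r`_(size Q).-1) q0.
  by rewrite coef0 coef_map => /eqP.
- rewrite rootE.
  have -> : q.[b] = p.[a].
    by rewrite -PE /q -!horner_swapXY swapXYK -horner2_swapXY.
  exact: pa.
Qed.

Fixpoint alg_indep S (s : seq F) : bool :=
  if s is x :: s' then (x \notin alg_span S) && alg_indep (x :: S) s' else true.

(** Steinitz exchange: each entry x of s takes the place of an element t of T,
    the first one that has to be added, from the end of T, before x becomes
    algebraic. *)
Lemma alg_indep_size S T (s : seq F) :
  alg_indep S s -> {subset s <= alg_span (T ++ S)} -> (size s <= size T)%N.
Proof.
elim: s S T => //= x s IHs S T /andP[xS sI] sT.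
have [T1 [t [T2 [TE xT2 xT1]]]] : exists T1 t T2, [/\ T = T1 ++ t :: T2,
    x \in alg_span (t :: T2 ++ S) & x \notin alg_span (T2 ++ S)].
  have : x \in alg_span (T ++ S) by rewrite sT// mem_head.
  elim: T {sT} => [|t T IHT] xT; first by rewrite xT in xS.
  have [xT'|xT'] := boolP (x \in alg_span (T ++ S)); last by exists [::], t, T.
  by have [T1 [t' [T2 [-> ? ?]]]] := IHT xT'; exists (t :: T1), t', T2.
have tT := alg_span_exchange xT2 xT1.
rewrite TE size_cat /= addnS ltnS -size_cat; apply: IHs sI _ => y ys.
have : y \in alg_span (T ++ S) by rewrite sT// inE ys orbT.
apply: alg_span_trans => {ys}y; rewrite TE !mem_cat inE -!orbA.
case/or4P=> [yT|/eqP->|yT|yS].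
- by apply: mem_alg_span; rewrite !mem_cat yT.
- apply: alg_spanS tT => {}y; rewrite !(inE, mem_cat).
  by case/or3P => ->; rewrite ?orbT.
- by apply: mem_alg_span; rewrite !mem_cat yT orbT.
- by apply: mem_alg_span; rewrite mem_cat inE yS !orbT.
Qed.

Lemma alg_indepPn S (s : seq F) : ~~ alg_indep S s ->
  exists2 k, (k < size s)%N & nth 0 s k \in alg_span (take k s ++ S).
Proof.
elim: s S => //= x s IHs S; rewrite negb_and negbK.
have [xS _|xS /= /IHs[k ks sk]] := boolP (x \in alg_span S).
  by exists 0%N; rewrite ?take0.
exists k.+1 => //=; apply: alg_spanS sk => y.
by rewrite !(inE, mem_cat); case/or3P => ->; rewrite ?orbT.
Qed.

Lemma polyOver_ring_span S p : p \is a polyOver (ring_span S) ->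
  exists es, p = Poly (map (peval (nth 0 S)) es).
Proof.
move=> pS.
have /choice[f fP] : forall i, exists e, p`_i = peval (nth 0 S) e.
  by move=> i; apply/ring_spanP/(polyOverP pS).
exists (mkseq f (size p)); apply/polyP => i; rewrite coef_Poly.
have [ip|ip] := ltnP i (size p).
  by rewrite (nth_map (PInt 0)) ?size_mkseq// nth_mkseq.
by rewrite !nth_default// size_map size_mkseq.
Qed.

Lemma finite_roots p : p != 0 -> finite_set [set a | root p a].
Proof.
move=> p0; apply: contrapT => /(infinite_set_fset (size p))[B Bp].
apply/negP; rewrite -ltnNge; apply: max_poly_roots p0 _ (finmap.fset_uniq B).
by apply/allP => a aB; apply: Bp.
Qed.

(** There are countably many integer expressions, and each nonzero polynomial
    has finitely many roots. *)
Lemma countable_alg_span S : countable [set a | a \in alg_span S].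
Proof.
pose P es := Poly (map (peval (nth 0 S)) es).
apply: (@sub_countable _ _ _
    (\bigcup_(es in [set es | P es != 0]) [set a | root (P es) a])).
  apply: subset_card_le => a /alg_spanP[p [/polyOver_ring_span[es ->] p0 pa]].
  by exists es.
apply: bigcup_countable => [|es /= es0]; first exact: countableP.
exact/finite_set_countable/finite_roots.
Qed.

End AlgebraicSpan.

Fixpoint pderiv (k : nat) (e : pexpr) : pexpr :=
  match e with
  | PVar i => PInt (i == k)%:R
  | PInt _ => PInt 0
  | PAdd e1 e2 => PAdd (pderiv k e1) (pderiv k e2)
  | PMul e1 e2 => PAdd (PMul (pderiv k e1) e2) (PMul e1 (pderiv k e2))
  end.

Section Slice.
Variables (F : numFieldType) (k : nat) (v : nat -> F).

(** The univariate polynomial obtained from e by freezing at v all the variables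
    but the k-th. *)
Definition pslice (e : pexpr) : {poly F} :=
  peval (fun i => if i == k then 'X else (v i)%:P) e.

Lemma horner_pslice e : (pslice e).[v k] = peval v e.
Proof.
rewrite -[LHS]/(horner_eval (v k) (pslice e)) peval_morph.
by apply: eq_peval => i /=; case: eqVneq => [->|_]; rewrite /horner_eval ?hornerX ?hornerC.
Qed.

Lemma deriv_pslice e : (pslice e)^`() = pslice (pderiv k e).
Proof.
rewrite /pslice; elim: e => [i|c|e1 IH1 e2 IH2|e1 IH1 e2 IH2] /=.
- by case: eqVneq => _; rewrite ?derivX ?derivC.
- by rewrite -(rmorph_int (@polyC F)) derivC.
- by rewrite derivD IH1 IH2.
- by rewrite derivM IH1 IH2.
Qed.

Lemma derivn_pslice n e : (pslice e)^`(n) = pslice (iter n (pderiv k) e).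
Proof. by elim: n => [|n IHn] //; rewrite derivnS IHn deriv_pslice. Qed.

(** Sets the variables of index at least k to 0, the value that they have when
    e is evaluated at a list of length k. *)
Fixpoint pclip (e : pexpr) : pexpr :=
  match e with
  | PVar i => if (i < k)%N then PVar i else PInt 0
  | PInt c => PInt c
  | PAdd e1 e2 => PAdd (pclip e1) (pclip e2)
  | PMul e1 e2 => PMul (pclip e1) (pclip e2)
  end.

Definition phorner (es : seq pexpr) : pexpr :=
  foldr (fun e acc => PAdd (PMul acc (PVar k)) (pclip e)) (PInt 0) es.

Lemma pslice_phorner es : pslice (phorner es) =
  Poly (map (peval (fun i => if (i < k)%N then v i else 0)) es).
Proof.
have clipE e : pslice (pclip e) =
    (peval (fun i => if (i < k)%N then v i else 0) e)%:P.
  rewrite peval_morph /pslice; elim: e => [i|c|e1 IH1 e2 IH2|e1 IH1 e2 IH2] //=.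
  - by case: ltnP => [ik|ik] //=; rewrite ltn_eqF.
  - by rewrite IH1 IH2.
  - by rewrite IH1 IH2.
elim: es => //= e es IHes; rewrite /pslice /= eqxx -!/(pslice _) clipE IHes.
by rewrite cons_poly_def.
Qed.

End Slice.

(** The order of vanishing of p at a is finite in characteristic 0. *)
Lemma root_derivn_simple (F : numFieldType) (p : {poly F}) a :
  p != 0 -> root p a -> exists n, root p^`(n) a && ~~ root p^`(n.+1) a.
Proof.
move=> p0 pa; apply: contrapT => noroot.
have allroot n : root p^`(n) a.
  elim: n => [|n IHn]; first by rewrite derivn0.
  by apply: contrapT => rn; apply: noroot; exists n; rewrite IHn; apply/negP.
have := allroot (size p).-1.
have -> : p^`((size p).-1) = (lead_coef p *+ (size p).-1`!)%:P.
  apply/polyP => i; rewrite coef_derivn coefC; case: i => [|i] /=.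
    by rewrite addn0 ffactnn lead_coefE.
  rewrite nth_default ?mul0rn// addnS -addSn prednK ?leq_addr//.
  by rewrite size_poly_gt0.
by rewrite rootC mulrn_eq0 lead_coef_eq0 (negPf p0) orbF eqn0Ngt fact_gt0.
Qed.

(** An algebraic dependency can be made nondegenerate: if the polynomial
    relation for the k-th entry has a multiple root there, one of its
    derivatives has a simple one.  This is the form in which the implicit
    function argument below needs it. *)
Lemma alg_span_simple_zero (F : numFieldType) (s : seq F) k :
  (k < size s)%N -> nth 0 s k \in alg_span (take k s) ->
  exists q, peval (nth 0 s) q = 0 /\ peval (nth 0 s) (pderiv k q) != 0.
Proof.
move=> ks /alg_spanP[p [/polyOver_ring_span[es pE] p0 pk]].
have {pE} pE : p = pslice k (nth 0 s) (phorner k es).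
  rewrite pslice_phorner pE; congr Poly; apply: eq_map => e.
  apply: eq_peval => i; case: ltnP => ik; first by rewrite nth_take.
  by rewrite nth_default// size_take ks.
have [n /andP[rn rSn]] := root_derivn_simple p0 pk.
exists (iter n (pderiv k) (phorner k es)); rewrite -!(horner_pslice k).
rewrite -deriv_pslice -!derivn_pslice -pE; split; first exact/eqP.
by rewrite -derivnS.
Qed.

(** * Low-rank quadratic forms vanishing on algebraically independent vectors *)

Section LowRankForms.
Variable F : numFieldType.

Definition qform M (Q : 'M[F]_M) (u : 'I_M -> F) : F :=
  \sum_(i < M) \sum_(j < M) Q i j * u i * u j.

(** A symmetric Q is determined by a nonsingular principal block: if the rows
    indexed by f form a basis of the row space, then Q = C Q_f, and the
    transposed relation expresses Q_f through the block of Q on f x f.  As C is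
    the identity on the rows f, only (M - r) r entries of C are free. *)
Lemma symmetric_rank_factor M (Q : 'M[F]_M) : Q^T = Q ->
  exists (f : 'I_(\rank Q) -> 'I_M) (C : 'M[F]_(M, \rank Q)),
    [/\ injective f, forall i j, C (f i) j = (i == j)%:R &
        Q = C *m mxsub f f Q *m C^T].
Proof.
move=> Qsym; pose f := maxrankfun Q; pose B := rowsub f Q.
have QB : (Q <= B)%MS by rewrite /B eq_maxrowsub.
pose C := Q *m pinvmx B.
have QE : C *m B = Q by rewrite /C mulmxKpV.
exists f, C; split; first exact: maxrankfun_inj.
- move=> i j; have /row_free_inj Binj : row_free B := maxrowsub_free Q.
  have : row (f i) C = row i 1%:M.
    by apply: Binj; rewrite -!row_mul QE mul1mx row_rowsub.
  by move=> /rowP/(_ j); rewrite !mxE.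
- have BE : B^T = C *m mxsub f f Q.
    have QijE i j : \sum_k C i k * Q (f k) j = Q i j.
      have := congr1 (fun X : 'M[F]_M => X i j) QE; rewrite mxE => <-.
      by apply: eq_bigr => k _; rewrite [B _ _]mxE.
    apply/matrixP => i j; rewrite 2!mxE [RHS]mxE.
    under [RHS]eq_bigr do rewrite [mxsub _ _ _ _ _]mxE.
    by rewrite QijE; have := congr1 (fun X : 'M[F]_M => X i (f j)) Qsym; rewrite mxE.
  by rewrite -BE -trmx_mul QE Qsym.
Qed.

Lemma card_ord_pairs_le r : #|[pred p : 'I_r * 'I_r | (p.1 <= p.2)%N]|.*2 = (r * r.+1)%N.
Proof.
rewrite -sum1_card -(pair_big_dep xpredT (fun i j : 'I_r => (i <= j)%N) (fun _ _ => 1%N)) /=.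
have -> : (\sum_(i < r) \sum_(j < r | i <= j) 1 = \sum_(i < r) (r - i))%N.
  apply: eq_bigr => i _; rewrite -(big_mkord (fun j => i <= j)%N (fun=> 1%N)).
  rewrite (big_cat_nat (n := i)) //=; last exact: ltnW.
  rewrite big_nat_cond big_pred0 ?add0n; last by move=> j; case: (ltnP j i) => ji; rewrite ?andbF.
  rewrite big_nat_cond (eq_bigl (fun j => (i <= j < r)%N)); last first.
    by move=> j; case: (leqP i j); rewrite ?andbT ?andbF.
  by rewrite -big_nat sum_nat_const_nat muln1.
elim: r => [|r IHr]; first by rewrite big_ord0.
rewrite big_ord_recl subn0 doubleD.
under eq_bigr do rewrite lift0 subSS.
by rewrite IHr; lia.
Qed.

(** For rank r there are r(r+1)/2 entries in the symmetric block and (M - r) r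
    in the rectangular one, and scaling one entry of the block to 1 saves a
    parameter.  For 1 <= r <= 4 <= M the total is largest at r = 4. *)
Lemma low_rank_parameters M (Q : 'M[F]_M) : (4 <= M)%N ->
  Q^T = Q -> (\rank Q <= 4)%N -> Q != 0 ->
  exists T : seq F, (size T <= 4 * M - 7)%N /\
    exists2 c, c != 0 & forall i j, c * Q i j \in alg_span T.
Proof.
move=> M4 Qsym rQ Q0.
have [f [C [finj Cf QE]]] := symmetric_rank_factor Qsym.
have rM := rank_leq_row Q; have r0 : (0 < \rank Q)%N by rewrite lt0n mxrank_eq0.
move: (\rank Q) => r in f C finj Cf QE rQ rM r0 *.
pose A := mxsub f f Q.
have Asym i j : A i j = A j i by rewrite !mxE -[in LHS]Qsym mxE.
have [i0 [j0 [ij0 A0]]] : exists i0 j0 : 'I_r, (i0 <= j0)%N /\ A i0 j0 != 0.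
  have /matrix0Pn[i [j Aij]] : A != 0.
    by apply: contraNneq Q0 => A0; rewrite QE -/A A0 mulmx0 mul0mx.
  have [ij|/ltnW ji] := leqP i j; first by exists i, j.
  by exists j, i; rewrite Asym.
pose c := (A i0 j0)^-1.
pose PA := [pred p : 'I_r * 'I_r | (p.1 <= p.2)%N & p != (i0, j0)].
pose PC := [pred p : 'I_M * 'I_r | p.1 \notin codom f].
pose TA := [seq c * A p.1 p.2 | p in PA].
pose TC := [seq C p.1 p.2 | p in PC].
exists (TA ++ TC); split.
  rewrite size_cat !size_image.
  have cA : (#|PA|.+1.*2 = r * r.+1)%N.
    rewrite -card_ord_pairs_le; congr _.*2.
    rewrite [RHS](cardD1 (i0, j0)) inE /= ij0 add1n; congr _.+1.
    by apply: eq_card => p; rewrite !inE andbC.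
  have cC : (#|PC| = (M - r) * r)%N.
    have -> : #|PC| = #|predX [predC (mem (codom f))] 'I_r|.
      by apply: eq_card => -[i j]; rewrite !inE andbT.
    rewrite cardX card_ord; congr (_ * _)%N.
    have := cardC (mem (codom f)); rewrite card_codom// !card_ord => ME.
    by rewrite -[in RHS]ME addKn.
  have : (r == 1 \/ r == 2 \/ r == 3 \/ r == 4)%N by lia.
  by rewrite cC; case=> [|[|[|]]] /eqP rE; move: (#|PA|) cA => a; rewrite rE; lia.
exists c; first by rewrite invr_eq0.
have CT i j : C i j \in alg_span (TA ++ TC).
  have [/codomP[k ->]|iC] := boolP (i \in codom f).
    by rewrite Cf; exact: rpred_nat.
  apply: mem_alg_span; rewrite mem_cat; apply/orP; right.
  by apply/fintype.imageP; exists (i, j).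
have AT' (i j : 'I_r) : (i <= j)%N -> c * A i j \in alg_span (TA ++ TC).
  move=> ij; have [[-> ->]|ne] := eqVneq (i, j) (i0, j0).
    by rewrite /c mulVf// rpred1.
  apply: mem_alg_span; rewrite mem_cat; apply/orP; left.
  by apply/fintype.imageP; exists (i, j) => //=; rewrite !inE ij.
have AT i j : c * A i j \in alg_span (TA ++ TC).
  by have [ij|/ltnW ji] := leqP i j; [|rewrite Asym]; exact: AT'.
move=> i j; rewrite QE -/A mxE mulr_sumr rpred_sum// => l _.
rewrite !mxE mulrA rpredM// mulr_sumr rpred_sum// => m _.
by rewrite mulrCA rpredM.
Qed.

(** Viewed as a polynomial in the coordinate u_k, the equation Q(u) = 0 has
    leading terms Q_kk u_k^2 + 2 b_k u_k with b_k the other part of (Q u)_k.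
    If for every k both coefficients vanish, then b_k = 0 is itself a
    nontrivial linear equation for some row k of Q. *)
Lemma quadric_coordinate_algebraic M (Q : 'M[F]_M) (u : 'I_M -> F) T :
  Q^T = Q -> Q != 0 -> (forall i j, Q i j \in alg_span T) -> qform Q u = 0 ->
  exists k, u k \in alg_span (T ++ [seq u i | i in predC1 k]).
Proof.
move=> Qsym Q0 QT Qu.
have sym i j : Q i j = Q j i by rewrite -[in LHS]Qsym mxE.
pose b k := \sum_(i | i != k) Q k i * u i.
pose c k := \sum_(i | i != k) \sum_(j | j != k) Q i j * u i * u j.
pose K k := alg_span (T ++ [seq u i | i in predC1 k]).
have QK k i j : Q i j \in K k.
  by apply: alg_spanS (QT i j) => x xT; rewrite mem_cat xT.
have uK k i : i != k -> u i \in K k.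
  move=> ik; apply: mem_alg_span; rewrite mem_cat; apply/orP; right.
  by apply/fintype.imageP; exists i.
have bK k : b k \in K k by apply: rpred_sum => i ik; rewrite rpredM ?QK ?uK.
have cK k : c k \in K k.
  by apply: rpred_sum => i ik; apply: rpred_sum => j jk; rewrite !rpredM ?QK ?uK.
have split k : Q k k * u k ^+ 2 + 2 * b k * u k + c k = 0.
  have rowE i : \sum_j Q i j * u i * u j =
      Q i k * u i * u k + \sum_(j | j != k) Q i j * u i * u j.
    by rewrite (bigD1 k).
  rewrite -Qu /qform (bigD1 k) //= rowE.
  rewrite (eq_bigr _ (fun i _ => rowE i)) big_split /= addrA -/(c k).
  congr (_ + _).
  have -> : \sum_(i | i != k) Q k i * u k * u i = b k * u k.
    by rewrite mulr_suml; apply: eq_bigr => i _; ring.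
  have -> : \sum_(i | i != k) Q i k * u i * u k = b k * u k.
    by rewrite mulr_suml; apply: eq_bigr => i _; rewrite sym.
  by ring.
have [[k]|none] := pselect (exists k, (Q k k != 0) || (b k != 0)).
  move=> Qb; exists k; pose p := (Q k k)%:P * 'X^2 + (2 * b k)%:P * 'X + (c k)%:P.
  apply: (@alg_span_root _ _ p).
  - apply: contraTneq Qb => p0; rewrite negb_or !negbK.
    have coefs i : p`_i = 0 by rewrite p0 coef0.
    have := coefs 2; rewrite !(coefD, coefCM, coefXn, coefX, coefC) /=.
    rewrite !(mulr0, mulr1, addr0, add0r) => ->; rewrite eqxx /=.
    have := coefs 1; rewrite !(coefD, coefCM, coefXn, coefX, coefC) /=.
    rewrite !(mulr0, mulr1, addr0, add0r) => /eqP.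
    by rewrite mulf_eq0 pnatr_eq0.
  - apply/eqP; rewrite /p !(hornerD, hornerCM, hornerXn, hornerX, hornerC).
    exact: split.
  - rewrite /p; apply: rpredD; last by rewrite polyOverC cK.
    apply: rpredD; apply: rpredM; rewrite ?polyOverXn ?polyOverX ?polyOverC ?QK//.
    by rewrite rpredM ?rpred_nat ?bK.
have {none} zero k : Q k k = 0 /\ b k = 0.
  by split; apply/eqP; apply: contrapT => /negP nz; apply: none; exists k; rewrite nz ?orbT.
have /matrix0Pn[k [l Qkl]] := Q0.
have lk : l != k by apply: contraNneq Qkl => ->; case: (zero k) => ->.
exists l; have [Qkk] := zero k; rewrite /b (bigD1 l) //= => /eqP.
rewrite addr_eq0 => /eqP ul.
have -> : u l = (Q k l)^-1 * - \sum_(i | (i != k) && (i != l)) Q k i * u i.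
  by rewrite -ul mulKf.
rewrite rpredM ?rpredV ?QK// rpredN rpred_sum// => i /andP[_ il].
by rewrite rpredM ?QK ?uK.
Qed.

Definition mx_entries M N (Phi : 'M[F]_(M, N)) : seq F :=
  [seq Phi p.1 p.2 | p : 'I_M * 'I_N].

(** The dimension count.  Such a form would make all the MN entries of Phi
    algebraic over the at most 4M - 7 parameters of the form together with
    M - 1 entries of each column, that is over fewer than MN elements. *)
Lemma indep_no_low_rank_form M N (Phi : 'M[F]_(M, N)) (Q : 'M[F]_M) :
  (4 <= M)%N -> (4 * M - 6 <= N)%N -> alg_indep [::] (mx_entries Phi) ->
  Q^T = Q -> (\rank Q <= 4)%N -> (forall n, qform Q (Phi^~ n) = 0) -> Q = 0.
Proof.
move=> M4 NM indep Qsym rQ QPhi; apply: contrapT => /eqP Q0.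
have [TQ [sTQ [c c0 QT]]] := low_rank_parameters M4 Qsym rQ Q0.
have /choice[k kP] : forall n, exists k,
    Phi k n \in alg_span (TQ ++ [seq Phi i n | i in predC1 k]).
  move=> n; apply: (@quadric_coordinate_algebraic _ (c *: Q) (Phi^~ n)).
  - by rewrite linearZ /= Qsym.
  - by rewrite scaler_eq0 negb_or c0.
  - by move=> i j; rewrite mxE.
  - rewrite -[RHS](mulr0 c) -(QPhi n) mulr_sumr; apply: eq_bigr => i _.
    by rewrite mulr_sumr; apply: eq_bigr => j _; rewrite mxE !mulrA.
pose P := [pred p : 'I_M * 'I_N | p.1 != k p.2].
pose T := TQ ++ [seq Phi p.1 p.2 | p in P].
have : (size (mx_entries Phi) <= size T)%N.
  apply: alg_indep_size indep _ => _ /fintype.imageP[[i n] _ ->] /=.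
  rewrite cats0; have PT j : j != k n -> Phi j n \in T.
    by move=> jk; rewrite mem_cat; apply/orP; right; apply/fintype.imageP; exists (j, n).
  have [->|ik] := eqVneq i (k n); last exact/mem_alg_span/PT.
  apply: alg_spanS (kP n) => x; rewrite mem_cat => /orP[xT|/fintype.imageP[j jk ->]].
    by rewrite mem_cat xT.
  exact: PT.
have cP : (#|P| = N * M.-1)%N.
  rewrite -sum1_card -(pair_big_dep xpredT (fun i n => i != k n) (fun _ _ => 1%N)) /=.
  rewrite (exchange_big_dep xpredT) //=.
  under eq_bigr do rewrite sum1_card cardC1 card_ord.
  by rewrite sum_nat_const card_ord.
rewrite size_cat !size_image cP card_prod !card_ord.
by case: M sTQ M4 NM {indep QPhi k kP P T cP Phi Q Qsym rQ Q0 QT} => // M; nia.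
Qed.

End LowRankForms.

(** * Null sets for the Lebesgue outer measure on matrices *)

Section NullSets.
Variables (R : realType) (m n : nat).
Implicit Types A B : set 'M[R]_(m, n).

Lemma mx_box_volume_ge0 (a b : 'M[R]_(m, n)) : 0 <= mx_box_volume a b.
Proof.
by apply: prodr_ge0 => i _; apply: prodr_ge0 => j _; rewrite le_max lexx.
Qed.

Lemma mx_lebesgue_eq0P A :
  (forall e : R, 0 < e -> (mx_lebesgue A <= e%:E)%E) <-> mx_lebesgue A = 0%E.
Proof.
split=> [Ae|-> e e0]; last by rewrite lee_fin ltW.
apply/eqP; rewrite eq_le; apply/andP; split.
  by apply/lee_addgt0Pr => e e0; rewrite add0e; exact: Ae.
apply/ereal_infP => _ [a [b [_ ->]]]; apply: nneseries_ge0 => k _ _.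
by rewrite lee_fin mx_box_volume_ge0.
Qed.

Lemma mx_lebesgue_sub A B : A `<=` B -> mx_lebesgue B = 0%E -> mx_lebesgue A = 0%E.
Proof.
move=> AB B0; apply/mx_lebesgue_eq0P => e e0.
apply: (@le_trans _ _ (mx_lebesgue B)); last by rewrite B0 lee_fin ltW.
apply: ereal_inf_le_tmp => _ [a [b [Bab ->]]]; exists a, b; split=> //.
exact: subset_trans Bab.
Qed.

Lemma mx_lebesgue_bigcup (A : nat -> set 'M[R]_(m, n)) :
  (forall k, mx_lebesgue (A k) = 0%E) -> mx_lebesgue (\bigcup_k A k) = 0%E.
Proof.
move=> A0; apply/mx_lebesgue_eq0P => e e0.
have /choice[ab abP] : forall k, exists ab : (nat -> 'M[R]_(m, n)) * (nat -> 'M[R]_(m, n)),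
    A k `<=` \bigcup_l mx_box (ab.1 l) (ab.2 l) /\
    (\sum_(0 <= l <oo) (mx_box_volume (ab.1 l) (ab.2 l))%:E <= (e / (2 ^ k.+1)%:R)%:E)%E.
  move=> k; have : (mx_lebesgue (A k) < (e / (2 ^ k.+1)%:R)%:E)%E.
    by rewrite A0 lte_fin divr_gt0// ltr0n expn_gt0.
  case/ereal_inf_lt => _ [a [b [Aab ->]]] lt_e.
  by exists (a, b); split=> //=; exact: ltW.
(* the double sequence of boxes is enumerated along nat * nat = nat *)
have /card_set_bijP[g gbij] : ([set: nat] #= [set: nat * nat])%card.
  by rewrite card_eq_sym card_nat2.
have [_ _ gsurj] := gbij.
apply: (@le_trans _ _ (\sum_(0 <= k <oo) (e / (2 ^ k.+1)%:R)%:E)%E); last first.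
  by apply: epsilon_trick0; exact: ltW.
apply: ge_ereal_inf; exists (\sum_(0 <= k <oo)
    (mx_box_volume ((ab (g k).1).1 (g k).2) ((ab (g k).1).2 (g k).2))%:E)%E.
  exists (fun k => (ab (g k).1).1 (g k).2), (fun k => (ab (g k).1).2 (g k).2).
  split=> // x [k _ /(abP k).1[l _ xl]].
  by have [p _ pE] := gsurj (k, l) I; exists p; rewrite //= pE.
pose v k l := (mx_box_volume ((ab k).1 l) ((ab k).2 l))%:E.
have v0 k l : (0 <= v k l)%E by rewrite lee_fin mx_box_volume_ge0.
rewrite nneseries_esumT//; last by move=> k; exact: v0.
rewrite -(@reindex_esum R _ _ _ _ g (fun p => v p.1 p.2) gbij).
rewrite -setXTT -(@esum_esum R _ _ setT (fun=> setT) v)//.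
rewrite -nneseries_esumT; last by move=> k; exact: esum_ge0.
apply: lee_nneseries => [k _ _|k _]; first exact: esum_ge0.
by rewrite -nneseries_esumT//; exact: (abP k).2.
Qed.

Lemma mx_lebesgue_countable_bigcup (T : countType) (t0 : T)
    (A : T -> set 'M[R]_(m, n)) :
  (forall t, mx_lebesgue (A t) = 0%E) -> mx_lebesgue (\bigcup_t A t) = 0%E.
Proof.
move=> A0; apply: mx_lebesgue_sub (mx_lebesgue_bigcup
    (A := fun k => A (odflt t0 (unpickle k))) (fun k => A0 _)).
by move=> x [t _ xt]; exists (pickle t) => //=; rewrite pickleK.
Qed.

(** The cover is padded to a sequence by boxes reduced to a point; these have
    volume 0 because there is at least one coordinate. *)
Lemma mx_lebesgue_finite_cover (T : finType) (t0 : T) (i0 : 'I_m) (j0 : 'I_n)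
    A (a b : T -> 'M[R]_(m, n)) :
  (forall x, A x -> exists t, mx_box (a t) (b t) x) ->
  (mx_lebesgue A <= (\sum_t mx_box_volume (a t) (b t))%:E)%E.
Proof.
move=> Aab; pose a' k := if (k < #|T|)%N then a (nth t0 (enum T) k) else 0.
pose b' k := if (k < #|T|)%N then b (nth t0 (enum T) k) else 0.
apply: ge_ereal_inf; exists (\sum_(0 <= k <oo) (mx_box_volume (a' k) (b' k))%:E)%E.
  exists a', b'; split=> // x /Aab[t xt]; exists (index t (enum T)) => //.
  by rewrite /a' /b' cardE index_mem mem_enum nth_index ?mem_enum.
rewrite (nneseries_split 0 #|T|)//; last first.
  by move=> k _; rewrite lee_fin mx_box_volume_ge0.
rewrite add0n eseries0 ?adde0; last first.
  move=> k Tk _; rewrite /a' /b' ltnNge Tk /=; congr EFin.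
  by rewrite /mx_box_volume (bigD1 i0)//= (bigD1 j0)//= subrr maxxx !mul0r.
rewrite -sumEFin -[X in (_ <= X)%E]big_enum /= (big_nth t0) -cardE.
rewrite big_nat_cond [X in (_ <= X)%E]big_nat_cond.
by apply: lee_sum => k /andP[/andP[_ kT] _]; rewrite /a' /b' kT.
Qed.

(** Cut the cube of radius r into cells of side d in all the coordinates but
    p0.  Over a cell the set stays within distance L d of any one of its
    points in the direction p0, so it fits in a box of volume
    2 L d * d^(mn - 1).  The number of cells is (2 r / d)^(mn - 1): the total
    volume is proportional to d. *)
Lemma mx_lebesgue_lipschitz_graph (p0 : 'I_m * 'I_n) A (r L d0 : R) :
  0 < r -> 0 < L -> 0 < d0 ->
  (forall x, A x -> forall p, `|x p.1 p.2| < r) ->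
  (forall x y d, A x -> A y -> 0 < d < d0 ->
    (forall p, p != p0 -> `|x p.1 p.2 - y p.1 p.2| <= d) ->
    `|x p0.1 p0.2 - y p0.1 p0.2| <= L * d) ->
  mx_lebesgue A = 0%E.
Proof.
move=> r0 L0 d00 Ar AL; apply/mx_lebesgue_eq0P => e e0.
(* the cells number (2 r / d)^(mn - 1), each of base volume d^(mn - 1); K is the product *)
pose K : R := \prod_(p : 'I_m * 'I_n | p != p0) (2 * r).
have K0 : 0 < K by apply: prodr_gt0 => p _; rewrite mulr_gt0.
have [s sd0 se] : exists2 s : nat, 2 * r / s.+1%:R < d0 &
    2 * (L * (2 * r / s.+1%:R)) * K <= e.
  pose z := Num.max (2 * r / d0) (2 * (L * (2 * r)) * K / e).
  have zs : z < (Num.truncn z).+1%:R by exact: truncnS_gt.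
  have z1 : 2 * r / d0 < (Num.truncn z).+1%:R.
    by apply: le_lt_trans zs; rewrite le_max lexx.
  have z2 : 2 * (L * (2 * r)) * K / e <= (Num.truncn z).+1%:R.
    by apply: le_trans (ltW zs); rewrite le_max lexx orbT.
  exists (Num.truncn z).
    by move: z1; rewrite !ltr_pdivrMr ?ltr0n// [d0 * _]mulrC.
  rewrite !mulrA -(mulrAC _ K) ler_pdivrMr ?ltr0n//.
  by move: z2; rewrite ler_pdivrMr// !mulrA [e * _]mulrC.
pose d : R := 2 * r / s.+1%:R.
have d_gt0 : 0 < d by rewrite divr_gt0 ?mulr_gt0 ?ltr0n.
have sd : s.+1%:R * d = 2 * r by rewrite /d mulrCA divff ?mulr1// pnatr_eq0.
pose cell (f : {ffun 'I_m * 'I_n -> 'I_s.+1}) (x : 'M[R]_(m, n)) :=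
  forall p, p != p0 -> (f p)%:R * d - r <= x p.1 p.2 <= (f p).+1%:R * d - r.
have /choice[y yP] : forall f, exists y, (exists2 x, A x & cell f x) -> A y /\ cell f y.
  move=> f; have [[x Ax fx]|no] := pselect (exists2 x, A x & cell f x).
    by exists x.
  by exists 0.
(* Cells carry an index for p0 as well; all but index 0 get a flat box, so that
   the sum of the volumes factors over the coordinates. *)
pose w (f : {ffun 'I_m * 'I_n -> 'I_s.+1}) : R := if f p0 == ord0 then L * d else 0.
pose a f := \matrix_(i, j) (if (i, j) == p0 then y f i j - w f
                            else (f (i, j))%:R * d - r).
pose b f := \matrix_(i, j) (if (i, j) == p0 then y f i j + w f
                            else (f (i, j)).+1%:R * d - r).
have cover x : A x -> exists f, mx_box (a f) (b f) x.
  move=> Ax.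
  have /choice[g gP] : forall p, exists v : 'I_s.+1, v%:R * d - r <= x p.1 p.2 <= v.+1%:R * d - r.
    move=> p; have /ltr_normlP[xr1 xr2] := Ar x Ax p.
    pose z := (x p.1 p.2 + r) / d.
    have z0 : 0 <= z by apply: divr_ge0; [lra|exact: ltW].
    have zs : (Num.truncn z < s.+1)%N.
      have : z < s.+1%:R by rewrite ltr_pdivrMr// sd; lra.
      by rewrite -truncn_lt_nat.
    exists (Ordinal zs) => /=; have /andP[z1 z2] := truncn_itv z0.
    move: z1 z2; rewrite ler_pdivlMr// ltr_pdivrMr// => z1 z2.
    by apply/andP; split; lra.
  pose f := [ffun p => if p == p0 then ord0 else g p].
  have fx : cell f x by move=> p pp0; rewrite /f ffunE (negPf pp0); exact: gP.
  have [Ay fy] : A (y f) /\ cell f (y f) by apply: yP; exists x.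
  exists f => i j; rewrite !mxE; case: eqP => [ijE|/eqP ij]; last exact: (fx (i, j)).
  have -> : w f = L * d by rewrite /w /f ffunE eqxx.
  rewrite -ler_distl; move: (AL x (y f) d Ax Ay).
  rewrite -ijE /=; apply; first by rewrite d_gt0.
  move=> p; rewrite ijE => pp0.
  have /andP[x1 x2] := fx p pp0; have /andP[y1 y2] := fy p pp0.
  move: x2 y2; rewrite -natr1 mulrDl mul1r => x2 y2.
  by rewrite ler_norml; apply/andP; split; lra.
apply: le_trans (mx_lebesgue_finite_cover [ffun=> ord0] p0.1 p0.2 cover) _.
rewrite lee_fin; apply: le_trans se.
pose c p (v : 'I_s.+1) := if p == p0 then (if v == ord0 then 2 * (L * d) else 0) else d.
have volE f : mx_box_volume (a f) (b f) = \prod_p c p (f p).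
  rewrite /mx_box_volume pair_bigA; apply: eq_bigr => -[i j] _; rewrite !mxE /c /=.
  case: eqP => [ijE|_].
    rewrite /w ijE; case: eqP => _; last by rewrite addr0 subr0 subrr maxxx.
    rewrite max_r; first by ring.
    by have := mulr_ge0 (ltW L0) (ltW d_gt0); lra.
  rewrite max_r -natr1; first by ring.
  by rewrite mulrDl mul1r; move: d_gt0; lra.
under eq_bigr do rewrite volE.
rewrite -bigA_distr_bigA (bigD1 p0)//= {1}/c eqxx -big_mkcond big_pred1_eq.
apply: ler_wpM2l; first by rewrite !mulr_ge0// ltW.
rewrite le_eqVlt; apply/orP; left; apply/eqP; apply: eq_bigr => p pp0.
by rewrite /c (negPf pp0) sumr_const card_ord -[LHS]mulr_natl sd.
Qed.

End NullSets.

(** * Matrices with algebraically dependent entries are null *)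

(** The divided difference of e in its j-th variable; it telescopes the
    difference of the values of e at v and w ([peval_sub]) and specializes to
    the partial derivative at v = w.  This replaces differential calculus on
    matrices by the continuity of polynomials. *)
Fixpoint pdiff (A : comNzRingType) (j : nat) (e : pexpr) (v w : nat -> A) : A :=
  match e with
  | PVar i => (i == j)%:R
  | PInt _ => 0
  | PAdd e1 e2 => pdiff j e1 v w + pdiff j e2 v w
  | PMul e1 e2 => pdiff j e1 v w * peval v e2 + peval w e1 * pdiff j e2 v w
  end.

Lemma pdiff_diag (A : comNzRingType) j e (v : nat -> A) :
  pdiff j e v v = peval v (pderiv j e).
Proof. by elim: e => //= [i|e1 -> e2 ->|e1 -> e2 ->] //; case: eqP. Qed.

Lemma peval_sub (A : comNzRingType) n e (v w : nat -> A) :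
  (forall i, (n <= i)%N -> v i = w i) ->
  peval v e - peval w e = \sum_(j < n) (v j - w j) * pdiff j e v w.
Proof.
move=> vw; elim: e => [i|c|e1 IH1 e2 IH2|e1 IH1 e2 IH2] /=.
- have [ni|ni] := leqP n i.
    rewrite vw// subrr big1// => j _; case: eqP => [ij|_]; last by rewrite mulr0.
    by move: (ltn_ord j); rewrite -ij ltnNge ni.
  rewrite (bigD1 (Ordinal ni))//= eqxx mulr1 big1 ?addr0// => j ji.
  case: eqP => [ij|_]; last by rewrite mulr0.
  by case/eqP: ji; apply: val_inj.
- by rewrite subrr big1// => j _; rewrite mulr0.
- rewrite opprD addrACA IH1 IH2 -big_split; apply: eq_bigr => j _ /=.
  by rewrite mulrDr.
- have -> : peval v e1 * peval v e2 - peval w e1 * peval w e2 =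
      (peval v e1 - peval w e1) * peval v e2 + peval w e1 * (peval v e2 - peval w e2).
    by ring.
  rewrite IH1 IH2 mulr_suml mulr_sumr -big_split; apply: eq_bigr => j _ /=.
  by ring.
Qed.

Section SimpleZeros.
Variables (R : realType) (m n : nat).
Implicit Types x y : 'M[R]_(m, n).

Let env x : nat -> R := nth 0 (mx_entries x).

Let env_enum_val x (j : 'I_#|{: 'I_m * 'I_n}|) :
  env x j = x (enum_val j).1 (enum_val j).2.
Proof. by rewrite /env /mx_entries nth_image. Qed.

Let env_default x j : (#|{: 'I_m * 'I_n}| <= j)%N -> env x j = 0.
Proof. by move=> jn; rewrite /env nth_default// size_image. Qed.

Let env_continuous j : continuous (fun x => env x j).
Proof.
have [jn|jn] := leqP #|{: 'I_m * 'I_n}| j.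
  rewrite (_ : (fun x => env x j) = cst 0); first exact: cst_continuous.
  by apply/funext => x; exact: env_default.
rewrite (_ : (fun x => env x j) =
    (fun x => x (enum_val (Ordinal jn)).1 (enum_val (Ordinal jn)).2)).
  exact: coord_continuous.
by apply/funext => x; rewrite -(env_enum_val x (Ordinal jn)).
Qed.

Let peval_continuous e : continuous (fun x => peval (env x) e).
Proof.
elim: e => [i|c|e1 IH1 e2 IH2|e1 IH1 e2 IH2] x /=.
- exact: env_continuous.
- exact: cst_continuous.
- exact: continuousD (IH1 x) (IH2 x).
- exact: continuousM (IH1 x) (IH2 x).
Qed.

Let pdiff_continuous j e x : continuous (fun y => pdiff j e (env x) (env y)).
Proof.
elim: e => [i|c|e1 IH1 e2 IH2|e1 IH1 e2 IH2] y /=.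
- exact: cst_continuous.
- exact: cst_continuous.
- exact: continuousD (IH1 y) (IH2 y).
- have c2 : continuous (fun _ : 'M[R]_(m, n) => peval (env x) e2).
    exact: cst_continuous.
  exact: continuousD (continuousM (IH1 y) (c2 y))
    (continuousM (@peval_continuous e1 y) (IH2 y)).
Qed.

Definition simple_zeros (q : pexpr) (k : nat) : set 'M[R]_(m, n) :=
  [set x | peval (env x) q = 0 /\ peval (env x) (pderiv k q) != 0].

(** The quantitative implicit function theorem: writing q(x) - q(y) = 0 as the
    sum of the (x_j - y_j) g_j(y), the coefficient g_k stays away from 0 and
    the others stay bounded when y is close to x.  A single integer N measures
    both the size of the neighbourhood and the Lipschitz constant, so that
    there are countably many cases. *)
Lemma simple_zeros_locally_graph q (k : 'I_#|{: 'I_m * 'I_n}|) x :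
  simple_zeros q k x -> exists N : nat, forall y d, simple_zeros q k y ->
  (forall p, `|x p.1 p.2 - y p.1 p.2| < N.+1%:R^-1) -> 0 <= d ->
  (forall p, p != enum_val k -> `|x p.1 p.2 - y p.1 p.2| <= d) ->
  `|x (enum_val k).1 (enum_val k).2 - y (enum_val k).1 (enum_val k).2| <= N.+1%:R * d.
Proof.
move=> [qx dqx]; pose g j y := pdiff j q (env x) (env y).
pose h y := \sum_(j < #|{: 'I_m * 'I_n}|) `|g j y|.
have gcont j : continuous (g j) by exact: pdiff_continuous.
have gkx : 0 < `|g k x| by rewrite normr_gt0 /g pdiff_diag.
have nearg : \forall y \near x, `|g k x| / 2 < `|g k y|.
  have : (fun y => `|g k y|) @ x --> `|g k x|.
    exact: cvg_norm (gcont k x).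
  by move/cvgr_gt; apply; lra.
have nearh : \forall y \near x, h y < h x + 1.
  have hcont : continuous h.
    apply: continuous_big => [|j _ y]; first exact: add_continuous.
    exact: cvg_norm (gcont j y).
  have : h @ x --> h x := hcont x.
  by move/cvgr_lt; apply; lra.
have [e /= e0 eP] : nbhs_ball x (fun y => `|g k x| / 2 < `|g k y| /\ h y < h x + 1).
  by apply/nbhs_ballP; exact: filterI nearg nearh.
pose B := h x + 1; have B0 : 0 < B.
  by rewrite ltr_wpDl// sumr_ge0.
pose z := Num.max (2 * B / `|g k x|) e^-1.
have zN : z < (Num.truncn z).+1%:R by exact: truncnS_gt.
have z1 : 2 * B / `|g k x| <= (Num.truncn z).+1%:R.
  by apply: le_trans (ltW zN); rewrite le_max lexx.
have z2 : (Num.truncn z).+1%:R^-1 <= e.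
  rewrite -[leRHS]invrK lef_pV2 ?posrE ?invr_gt0 ?ltr0n//.
  by apply: le_trans (ltW zN); rewrite le_max lexx orbT.
exists (Num.truncn z) => y d [qy _] xy d0 yd.
have [gky hy] : `|g k x| / 2 < `|g k y| /\ h y < B.
  apply: eP; split=> // i j; apply: lt_le_trans z2; exact: (xy (i, j)).
have := @peval_sub _ #|{: 'I_m * 'I_n}| q (env x) (env y).
rewrite qx qy subrr (bigD1 k) //= => /(_ _)/esym/eqP.
rewrite addr_eq0 !env_enum_val => E.
apply: le_trans (ler_wpM2r d0 z1).
have key : `|x (enum_val k).1 (enum_val k).2 - y (enum_val k).1 (enum_val k).2| *
    `|g k y| <= d * B.
  rewrite -normrM (eqP (E _)); last first.
    by move=> i ni; rewrite !env_default.
  rewrite normrN; apply: le_trans (ler_norm_sum _ _ _) _.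
  apply: (@le_trans _ _ (\sum_(j < #|{: 'I_m * 'I_n}| | j != k) d * `|g j y|)).
    apply: ler_sum => j jk; rewrite normrM ler_wpM2r// !env_enum_val; apply: yd.
    by apply: contraNneq jk => /enum_val_inj ->.
  rewrite -mulr_sumr ler_wpM2l//; apply: le_trans (ltW hy).
  by rewrite /h [leRHS](bigD1 k)//= lerDr.
rewrite mulrAC ler_pdivlMr//.
have : `|x (enum_val k).1 (enum_val k).2 - y (enum_val k).1 (enum_val k).2| *
    (`|g k x| / 2) <= d * B.
  by apply: le_trans key; rewrite ler_wpM2l// ltW.
by lra.
Qed.

(** Sort the zeros by a bound r on their entries, by the constant N of the
    previous lemma, and by the slab of width 1 / (2 (N + 1)) that contains the
    k-th coordinate; within a slab, two zeros that are close in the other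
    coordinates are close enough to compare. *)
Lemma mx_lebesgue_simple_zeros q (k : 'I_#|{: 'I_m * 'I_n}|) :
  mx_lebesgue (simple_zeros q k) = 0%E.
Proof.
set p0 := enum_val k.
pose E (t : nat * nat * int) : set 'M[R]_(m, n) :=
  let: (r, N, z) := t in
  [set x | [/\ simple_zeros q k x, forall p, `|x p.1 p.2| < r.+1%:R,
    forall y d, simple_zeros q k y ->
      (forall p, `|x p.1 p.2 - y p.1 p.2| < N.+1%:R^-1) -> 0 <= d ->
      (forall p, p != p0 -> `|x p.1 p.2 - y p.1 p.2| <= d) ->
      `|x p0.1 p0.2 - y p0.1 p0.2| <= N.+1%:R * d &
    z%:~R <= x p0.1 p0.2 * (2 * N.+1%:R) < (z + 1)%:~R]].
apply: (@mx_lebesgue_sub _ _ _ _ (\bigcup_t E t)); last first.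
  apply: (mx_lebesgue_countable_bigcup (0%N, 0%N, 0)) => -[[r N] z].
  apply: (@mx_lebesgue_lipschitz_graph _ _ _ p0 _ r.+1%:R N.+1%:R N.+1%:R^-1).
  - by rewrite ltr0n.
  - by rewrite ltr0n.
  - by rewrite invr_gt0 ltr0n.
  - by move=> x [].
  - move=> x y d [xq _ xL /andP[xz1 xz2]] [yq _ _ /andP[yz1 yz2]] /andP[d0 dN] xyd.
    have N0 : 0 < N.+1%:R :> R by rewrite ltr0n.
    apply: xL => //; last exact: ltW.
    move=> p; have [->|pp0] := eqVneq p p0; last exact: le_lt_trans (xyd p pp0) dN.
    rewrite -[ltRHS]mul1r ltr_pdivlMr//.
    rewrite -[X in _ * X](ger0_norm (ltW N0)) -normrM.
    move: xz2 yz2; rewrite intrD /= => xz2 yz2.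
    by rewrite ltr_norml; apply/andP; split; lra.
move=> x xq; have [N Nx] := simple_zeros_locally_graph xq.
pose h := \sum_p `|x p.1 p.2|.
exists (Num.truncn h, N, Num.floor (x p0.1 p0.2 * (2 * N.+1%:R))) => //; split=> //.
- move=> p; apply: le_lt_trans (truncnS_gt _).
  by rewrite /h (bigD1 p)//= lerDl sumr_ge0.
- by rewrite floor_le_tmp floorD1_gt.
Qed.

Lemma mx_lebesgue_dependent (i0 : 'I_m) (j0 : 'I_n) :
  mx_lebesgue [set x : 'M[R]_(m, n) | ~~ alg_indep [::] (mx_entries x)] = 0%E.
Proof.
pose k0 := enum_rank (i0, j0).
apply: mx_lebesgue_sub (mx_lebesgue_countable_bigcup (PInt 0, k0)
  (fun t => mx_lebesgue_simple_zeros t.1 t.2)).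
move=> x /= /alg_indepPn[k kx]; rewrite cats0 => xk.
have [q [qx dqx]] := alg_span_simple_zero kx xk.
have kI : (k < #|{: 'I_m * 'I_n}|)%N by rewrite -(size_image (fun p => x p.1 p.2)).
by exists (q, Ordinal kI).
Qed.

End SimpleZeros.

(** * Matrices with algebraically independent entries are dense *)

Section Density.
Variable R : realType.

(** A countable set cannot contain an interval of positive length. *)
Lemma exists_transcendental_near (S : seq R) (t e : R) : 0 < e ->
  exists2 x, x \notin alg_span S & `|t - x| < e.
Proof.
move=> e0; apply: contrapT => none.
have sub : `]t - e, t + e[%classic `<=` [set x | x \in alg_span S].
  move=> x /=; rewrite in_itv /= => xte; apply: contrapT => /negP xS.
  by apply: none; exists x => //; rewrite distrC ltr_distl.
have := countable_lebesgue_measure0 (sub_countable (subset_card_le sub) (countable_alg_span S)).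
rewrite lebesgue_measure_itv /= lte_fin ifT; last by lra.
by rewrite -EFinB => /eqP; rewrite eqe; apply/negP; rewrite gt_eqF//; lra.
Qed.

Lemma exists_alg_indep_near (S s : seq R) (e : R) : 0 < e ->
  exists s', [/\ size s' = size s, alg_indep S s' &
    forall i, `|nth 0 s i - nth 0 s' i| < e].
Proof.
move=> e0; elim: s S => [|t s IHs] S.
  by exists [::]; split=> // i; rewrite subrr normr0.
have [x xS tx] := exists_transcendental_near S t e0.
have [s' [ss' s'I ss'e]] := IHs (x :: S).
exists (x :: s'); split=> /=; [by rewrite ss'|by rewrite xS|].
by case.
Qed.

Lemma dense_alg_indep M N :
  dense [set Phi : 'M[R]_(M, N) | alg_indep [::] (mx_entries Phi)].
Proof.
move=> O [Phi0 OPhi0] Oopen.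
have [e /= e0 eO] : nbhs_ball Phi0 O by apply/nbhs_ballP; exact: open_nbhs_nbhs.
have [s [ss sI se]] := exists_alg_indep_near [::] (mx_entries Phi0) e0.
pose Phi := \matrix_(i < M, j < N) nth 0 s (enum_rank (i, j)).
exists Phi; split.
  apply: eO; split=> // i j; have := se (enum_rank (i, j)).
  by rewrite nth_image enum_rankK mxE.
rewrite /=; have -> : mx_entries Phi = s => //.
apply: (@eq_from_nth _ 0); first by rewrite ss !size_image.
move=> i; rewrite size_image => ilt.
by rewrite (nth_image _ _ (Ordinal ilt)) mxE -surjective_pairing enum_valK.
Qed.

End Density.

(** * Conjugate phase retrieval in terms of real quadratic forms *)

Local Open Scope complex_scope.

Section GramForm.
Variables (R : realType) (M : nat).
Implicit Types x y : 'cV[R[i]]_M.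

(** The real part of x x^*, which is the matrix of phi |-> |<x, phi>|^2 on real
    vectors phi. *)
Definition re_gram x : 'M[R]_M :=
  \matrix_(i, j) (complex.Re (x i 0) * complex.Re (x j 0) +
                  complex.Im (x i 0) * complex.Im (x j 0)).

Lemma re_gram_sym x : (re_gram x)^T = re_gram x.
Proof. by apply/matrixP => i j; rewrite !mxE mulrC [X in _ + X]mulrC. Qed.

Lemma re_gramE x : re_gram x =
  map_mx (@complex.Re R) x *m (map_mx (@complex.Re R) x)^T +
  map_mx (@complex.Im R) x *m (map_mx (@complex.Im R) x)^T.
Proof. by apply/matrixP => i j; rewrite !mxE !big_ord1 !mxE. Qed.

Lemma rank_re_gram_sub x y : (\rank (re_gram x - re_gram y)%R <= 4)%N.
Proof.
have r2 z : (\rank (re_gram z) <= 2)%N.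
  rewrite re_gramE; apply: leq_trans (mxrank_add _ _) _.
  by rewrite (leq_add (mulmx_max_rank _ _) (mulmx_max_rank _ _)).
by apply: leq_trans (mxrank_add _ _) _; rewrite mxrank_opp (leq_add (r2 _) (r2 _)).
Qed.

Lemma qform_re_gram x (u : 'I_M -> R) : qform (re_gram x) u =
  (\sum_j complex.Re (x j 0) * u j) ^+ 2 + (\sum_j complex.Im (x j 0) * u j) ^+ 2.
Proof.
rewrite !expr2 !mulr_suml -big_split; apply: eq_bigr => i _ /=.
rewrite !mulr_sumr -big_split; apply: eq_bigr => j _ /=.
by rewrite mxE; ring.
Qed.

Lemma qformB (P Q : 'M[R]_M) u : qform (P - Q) u = qform P u - qform Q u.
Proof.
rewrite /qform -sumrB; apply: eq_bigr => i _; rewrite -sumrB.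
by apply: eq_bigr => j _; rewrite !mxE; ring.
Qed.

Lemma normc_eq (z w : R[i]) : `|z| = `|w| <->
  complex.Re z ^+ 2 + complex.Im z ^+ 2 = complex.Re w ^+ 2 + complex.Im w ^+ 2.
Proof.
rewrite !normc_def; split=> [/complexI|->//] /eqP.
by rewrite eqr_sqrt ?addr_ge0 ?sqr_ge0// => /eqP.
Qed.

Lemma cinner_complex_columns N (Phi : 'M[R]_(M, N)) x n :
  cinner x (complex_columns Phi n) =
  (\sum_j complex.Re (x j 0) * Phi j n) +i* (\sum_j complex.Im (x j 0) * Phi j n).
Proof.
rewrite /cinner.
have -> : \sum_(j < M) x j 0 * Num.conj (complex_columns Phi n j 0) =
    \sum_(j < M) ((complex.Re (x j 0) * Phi j n) +i* (complex.Im (x j 0) * Phi j n)).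
  apply: eq_bigr => j _; rewrite !mxE; case: (x j 0) => a b /=.
  by apply/eqP; rewrite eq_complex /= oppr0 !mulr0 subr0 add0r !eqxx.
by elim/big_rec3 : _ => // j a b c _ ->.
Qed.

Lemma measurements_eq N (Phi : 'M[R]_(M, N)) x y :
  (forall n, `|cinner x (complex_columns Phi n)| = `|cinner y (complex_columns Phi n)|)
  <-> (forall n, qform (re_gram x - re_gram y) (Phi^~ n) = 0).
Proof.
split=> xy n; have := xy n; rewrite !cinner_complex_columns qformB !qform_re_gram.
  by move/normc_eq => /= ->; rewrite subrr.
by move/eqP; rewrite subr_eq0 => /eqP xyn; apply/normc_eq.
Qed.

Lemma unit_circle_cos_sin (u v : R) : u ^+ 2 + v ^+ 2 = 1 ->
  exists t, cos t = u /\ sin t = v.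
Proof.
move=> uv; have u1 : -1 <= u <= 1.
  rewrite -ler_norml -[leRHS]normr1 -ler_sqr ?nnegrE// !real_normK ?num_real//.
  by rewrite expr1n -uv lerDl sqr_ge0.
have su : Num.sqrt (1 - u ^+ 2) = `|v| by rewrite -uv addrAC subrr add0r sqrtr_sqr.
have [v0|/ltW v0] := leP 0 v.
  by exists (acos u); rewrite acosK// sin_acos// su ger0_norm.
by exists (- acos u); rewrite cosN sinN acosK// sin_acos// su ler0_norm// opprK.
Qed.

Lemma re_gram_rotate t x : re_gram (expi t *: x) = re_gram x.
Proof.
apply/matrixP => i j; rewrite !mxE /expi; case: (x i 0) => a b; case: (x j 0) => c d /=.
transitivity ((cos t ^+ 2 + sin t ^+ 2) * (a * c + b * d)); first by ring.
by rewrite cos2Dsin2 mul1r.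
Qed.

Lemma re_gram_conj x : re_gram (cconj x) = re_gram x.
Proof.
apply/matrixP => i j; rewrite !mxE; case: (x i 0) => a b; case: (x j 0) => c d /=.
by rewrite mulrNN.
Qed.

(** Fix an entry k with y_k <> 0.  The products x_j conj(x_k) and
    y_j conj(y_k) have the same real parts p_j by hypothesis.  Since G_x
    also determines the products q_i q_j of their imaginary parts, the latter
    agree up to one global sign s.  According to s, x is then obtained from y
    or from its conjugate by the rotation that matches the k-th entries. *)
Lemma re_gram_inj x y : re_gram x = re_gram y ->
  exists t, x = expi t *: y \/ x = expi t *: cconj y.
Proof.
move=> /matrixP xy.
pose a i := complex.Re (x i 0); pose b i := complex.Im (x i 0).
pose c i := complex.Re (y i 0); pose d i := complex.Im (y i 0).
have G i j : a i * a j + b i * b j = c i * c j + d i * d j.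
  by have := xy i j; rewrite !mxE.
have xE i : x i 0 = a i +i* b i by rewrite /a /b; case: (x i 0).
have yE i : y i 0 = c i +i* d i by rewrite /c /d; case: (y i 0).
have [[k yk]|y0] := pselect (exists k, c k ^+ 2 + d k ^+ 2 != 0); last first.
  exists 0; left; apply/matrixP => i j; rewrite (ord1 j) !mxE.
  have cd : c i ^+ 2 + d i ^+ 2 = 0.
    by apply/eqP; apply: contrapT => /negP ne; apply: y0; exists i.
  have ab : a i ^+ 2 + b i ^+ 2 = 0 by rewrite -cd !expr2 G.
  move: cd ab => /eqP; rewrite paddr_eq0 ?sqr_ge0// !sqrf_eq0 => /andP[/eqP ci /eqP di].
  move=> /eqP; rewrite paddr_eq0 ?sqr_ge0// !sqrf_eq0 => /andP[/eqP ai /eqP bi].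
  by rewrite xE yE ai bi ci di /expi; apply/eqP; rewrite eq_complex /= !mulr0 subr0 addr0 eqxx.
pose r := c k ^+ 2 + d k ^+ 2.
have rE : r = a k ^+ 2 + b k ^+ 2 by rewrite /r !expr2 G.
pose q i := d i * c k - c i * d k.
pose q' i := b i * a k - a i * b k.
have qq i j : q' i * q' j = q i * q j.
  (* p_i p_j + q_i q_j = |y_k|^2 Re (y_i conj y_j), and likewise for x *)
  have e1 : q i * q j =
      r * (c i * c j + d i * d j) - (c i * c k + d i * d k) * (c j * c k + d j * d k).
    by rewrite /q /r; ring.
  have e2 : q' i * q' j =
      r * (a i * a j + b i * b j) - (a i * a k + b i * b k) * (a j * a k + b j * b k).
    by rewrite /q' rE; ring.
  by rewrite e1 e2 !G.
have [s [s1 qs]] : exists s : R, s ^+ 2 = 1 /\ forall i, q' i = s * q i.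
  have [[l ql]|q0] := pselect (exists l, q l != 0); last first.
    exists 1; split=> [|i]; first by rewrite expr1n.
    have qi : q i = 0 by apply/eqP; apply: contrapT => /negP ne; apply: q0; exists i.
    by have /eqP := qq i i; rewrite qi !mulr0 mulf_eq0 orbb => /eqP.
  have ql' : q' l != 0.
    by apply: contraNneq ql => ql0; have /eqP := qq l l; rewrite ql0 mul0r eq_sym mulf_eq0 orbb.
  exists (q l / q' l); split.
    by rewrite expr_div_n !expr2 qq divff// mulf_neq0.
  move=> i; apply: (mulIf ql'); rewrite qq; field.
  by [].
(* the rotation taking y_k (or its conjugate) to x_k *)
pose u := (a k * c k + s * (b k * d k)) / r.
pose v := (b k * c k - s * (a k * d k)) / r.
have uv : u ^+ 2 + v ^+ 2 = 1.
  have -> : u ^+ 2 + v ^+ 2 = (a k ^+ 2 + b k ^+ 2) * (c k ^+ 2 + s ^+ 2 * d k ^+ 2) / r ^+ 2.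
    by rewrite /u /v; field.
  by rewrite s1 mul1r -rE -/r -expr2 divff// expf_neq0.
have aE i : a i = u * c i - s * (v * d i).
  apply: (mulIf yk); rewrite -/r.
  have -> : a i * r = a k * (a i * a k + b i * b k) - b k * q' i.
    by rewrite rE /q'; ring.
  have -> : (u * c i - s * (v * d i)) * r =
      a k * (c k * c i + s ^+ 2 * (d k * d i)) - b k * (s * (d i * c k - c i * d k)).
    by rewrite /u /v; field.
  by rewrite G qs s1 /q; ring.
have bE i : b i = v * c i + s * (u * d i).
  apply: (mulIf yk); rewrite -/r.
  have -> : b i * r = b k * (a i * a k + b i * b k) + a k * q' i.
    by rewrite rE /q'; ring.
  have -> : (v * c i + s * (u * d i)) * r =
      b k * (c k * c i + s ^+ 2 * (d k * d i)) + a k * (s * (d i * c k - c i * d k)).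
    by rewrite /u /v; field.
  by rewrite G qs s1 /q; ring.
have [t [ct st]] := unit_circle_cos_sin uv.
exists t; have := s1 => /eqP; rewrite -subr_eq0 -[1](expr1n _ 2) subr_sqr mulf_eq0.
rewrite subr_eq0 addr_eq0 => /orP[/eqP sE|/eqP sE]; [left|right];
  apply/matrixP => i j; rewrite (ord1 j) !mxE xE yE /expi ct st aE bE sE /=;
  apply/eqP; rewrite eq_complex /=; apply/andP; split; apply/eqP; ring.
Qed.

Lemma conj_phase_retrievableP N (Phi : 'M[R]_(M, N)) :
  conj_phase_retrievable (complex_columns Phi) <->
  forall x y, (forall n, qform (re_gram x - re_gram y) (Phi^~ n) = 0) ->
    re_gram x = re_gram y.
Proof.
split=> [PR x y /measurements_eq/PR[t [->|->]]|inj x y /measurements_eq xy].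
- exact: re_gram_rotate.
- by rewrite re_gram_rotate re_gram_conj.
- exact/re_gram_inj/inj.
Qed.

(** A nonzero vector of the left kernel has the same measurements as 0. *)
Lemma conj_phase_retrievable_rank N (Phi : 'M[R]_(M, N)) :
  conj_phase_retrievable (complex_columns Phi) -> \rank Phi = M.
Proof.
move=> PR; apply/eqP; rewrite -/(row_free Phi) -kermx_eq0; apply/rowV0P => v /sub_kermxP vPhi.
have [t] : exists t : R, map_mx (real_complex R) v^T = expi t *: 0 \/
    map_mx (real_complex R) v^T = expi t *: cconj 0.
  apply: PR => n; congr (`| _ |); rewrite !cinner_complex_columns.
  have z1 : \sum_j v 0 j * Phi j n = 0.
    by have /matrixP/(_ 0 n) := vPhi; rewrite !mxE.
  rewrite (eq_bigr (fun j => v 0 j * Phi j n)); last by move=> j _; rewrite !mxE.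
  rewrite z1 !big1// => j _; by rewrite !mxE /= mul0r.
have -> : cconj 0 = 0 :> 'cV[R[i]]_M by apply/matrixP => i j; rewrite !mxE conjC0.
rewrite scaler0 => v0; apply/matrixP => i j; rewrite (ord1 i) mxE.
have : map_mx (real_complex R) v^T j 0 = 0 by case: v0 => ->; rewrite mxE.
by rewrite !mxE => /complexI.
Qed.

Lemma indep_conj_phase_retrievable N (Phi : 'M[R]_(M, N)) :
  (4 <= M)%N -> (4 * M - 6 <= N)%N -> alg_indep [::] (mx_entries Phi) ->
  conj_phase_retrievable (complex_columns Phi).
Proof.
move=> M4 NM indep; apply/conj_phase_retrievableP => x y xy; apply/eqP.
rewrite -subr_eq0; apply/eqP/(indep_no_low_rank_form M4 NM indep) => //.
  by rewrite linearB /= !re_gram_sym.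
exact: rank_re_gram_sub.
Qed.

End GramForm.

(** * Signature of the differences of Gram forms *)

Section Signature.
Variables (R : realType) (M : nat).
Implicit Types (Q : 'M[R]_M) (x y : 'cV[R[i]]_M).

(** Q restricts to an inner product on a k-dimensional space, that is, Q has at
    least k positive eigenvalues; exhibiting an orthonormal family avoids
    eigenvalues and determinants. *)
Definition represents_identity k Q := exists V : 'M[R]_(k, M), V *m Q *m V^T = 1%:M.

Definition gram_difference Q := exists x y, Q = re_gram x - re_gram y.

Lemma positive_represents_identity Q (v : 'rV[R]_M) :
  0 < (v *m Q *m v^T) 0 0 -> represents_identity 1 Q.
Proof.
set h := (_ 0 0) => h0; exists ((Num.sqrt h)^-1 *: v).
rewrite linearZ /= -scalemxAl -scalemxAl -scalemxAr scalerA.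
rewrite [v *m Q *m v^T]mx11_scalar -/h scale_scalar_mx -expr2 exprVn sqr_sqrtr ?ltW//.
by rewrite mulVf// gt_eqF.
Qed.

(** One step of the reduction of a quadratic form to squares.  With w such that
    w Q w^T = 1 and a = Q w^T, the form Q - a a^T has w in its kernel and
    agrees with Q on the orthogonal of w.  An orthonormal family of
    Q - a a^T, projected onto this orthogonal, is orthonormal for Q, and w
    extends it; a family on which the form is negative is projected likewise.
    So the positive index drops and the negative one does not grow.  When Q is
    nowhere positive, a = 0 works. *)
Lemma split_off_square Q k l : Q^T = Q ->
  ~ represents_identity k.+2 Q -> ~ represents_identity l (- Q) ->
  exists a : 'cV[R]_M, ~ represents_identity k.+1 (Q - a *m a^T) /\
    ~ represents_identity l (- (Q - a *m a^T)).
Proof.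
move=> Qsym nk nl.
have [[w wQw]|none] := pselect (represents_identity 1 Q); last first.
  exists 0; rewrite mul0mx subr0; split=> //.
  case=> V VQ; apply: none; exists (row 0 V).
  rewrite tr_row -row_mul; apply/matrixP => i j.
  have := congr1 (fun X : 'M[R]_(k.+1) => X 0 0) VQ.
  by rewrite !(ord1 i) !(ord1 j) !mxE => <-; apply: eq_bigr => p _; rewrite !mxE.
pose a := Q *m w^T; exists a; set Q1 := Q - _.
have aT : a^T = w *m Q by rewrite trmx_mul trmxK Qsym.
have wa : w *m a = 1%:M by rewrite mulmxA.
have wQ1 : w *m Q1 = 0 by rewrite mulmxBr mulmxA wa mul1mx aT subrr.
have Q1w : Q1 *m w^T = 0.
  rewrite mulmxBl -/a -mulmxA -trmx_mul wa trmx1 mulmx1 subrr.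
  by [].
pose V' p (V : 'M[R]_(p, M)) := V - V *m a *m w.
have V'a p (V : 'M[R]_(p, M)) : V' p V *m a = 0.
  by rewrite /V' mulmxBl -[_ *m w *m a]mulmxA wa mulmx1 subrr.
have V'Q p (V : 'M[R]_(p, M)) : V' p V *m Q *m (V' p V)^T = V *m Q1 *m V^T.
  have -> : V' p V *m Q = V' p V *m Q1.
    by rewrite /Q1 [RHS]mulmxBr mulmxA V'a mul0mx subr0.
  have -> : V' p V *m Q1 = V *m Q1.
    by rewrite /V' mulmxBl -[_ *m w *m Q1]mulmxA wQ1 mulmx0 subr0.
  rewrite /V' [(_ - _)^T]linearB /= [LHS]mulmxBr [(_ *m w)^T]trmx_mul mulmxA.
  rewrite -[_ *m Q1 *m w^T]mulmxA Q1w mulmx0 mul0mx.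
  by rewrite subr0.
split=> [[V VQ1]|[V VQ1]].
  have WQ : col_mx w (V' _ V) *m Q *m (col_mx w (V' _ V))^T = 1%:M.
    rewrite tr_col_mx mul_col_mx mul_col_row wQw V'Q VQ1.
    have -> : V' _ V *m Q *m w^T = 0 by rewrite -mulmxA V'a.
    have -> : w *m Q *m (V' _ V)^T = 0 by rewrite -aT -trmx_mul V'a trmx0.
    by rewrite -scalar_mx_block.
  by apply: nk; exists (col_mx w (V' _ V)).
apply: nl; exists (V' _ V).
by rewrite mulmxN mulNmx V'Q -mulNmx -mulmxN.
Qed.

Lemma semidefinite_eq0 Q : Q^T = Q -> ~ represents_identity 1 Q ->
  ~ represents_identity 1 (- Q) -> Q = 0.
Proof.
move=> Qsym n1 n2.
have Q0 (v : 'rV[R]_M) : (v *m Q *m v^T) 0 0 = 0.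
  apply/eqP; rewrite eq_le !leNgt; apply/andP; split; apply/negP => h.
    exact/n1/positive_represents_identity/h.
  apply/n2/(@positive_represents_identity _ v).
  by rewrite mulmxN mulNmx mxE oppr_gt0.
pose e i : 'rV[R]_M := delta_mx 0 i.
have Qe i j : (e i *m Q *m (e j)^T) 0 0 = Q i j.
  by rewrite /e -rowE trmx_delta -colE !mxE.
apply/matrixP => i j; rewrite mxE.
have := Q0 (e i + e j).
have D (X Y : 'M[R]_1) : (X + Y) 0 0 = X 0 0 + Y 0 0 by rewrite mxE.
rewrite [(e i + e j)^T]linearD /= !mulmxDl !mulmxDr !D !Q0 !Qe.
have -> : Q j i = Q i j by rewrite -[in LHS]Qsym mxE.
lra.
Qed.

(** Split off two squares from Q, then two from the negative of what remains:
    the rest is semidefinite of both signs, hence 0. *)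
Lemma gram_differenceP Q : Q^T = Q -> ~ represents_identity 3 Q ->
  ~ represents_identity 3 (- Q) -> gram_difference Q.
Proof.
have sqsym (a : 'cV[R]_M) : (a *m a^T)^T = a *m a^T by rewrite trmx_mul trmxK.
move=> Qsym n1 n2.
have [a [{}n1 {}n2]] := split_off_square Qsym n1 n2.
set Q1 := Q - _ in n1 n2; have Q1sym : Q1^T = Q1 by rewrite linearB /= sqsym Qsym.
have [b [{}n1 {}n2]] := split_off_square Q1sym n1 n2.
set Q2 := Q1 - _ in n1 n2; have Q2sym : (- Q2)^T = - Q2 by rewrite linearN linearB /= sqsym Q1sym.
rewrite -[Q2]opprK in n1.
have [c [{}n2 {}n1]] := split_off_square Q2sym n2 n1.
set Q3 := - Q2 - _ in n1 n2; have Q3sym : Q3^T = Q3 by rewrite linearB /= sqsym Q2sym.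
have [d [{}n2 {}n1]] := split_off_square Q3sym n2 n1.
set Q4 := Q3 - _ in n1 n2; have Q4sym : Q4^T = Q4 by rewrite linearB /= sqsym Q3sym.
have Q40 := semidefinite_eq0 Q4sym n2 n1.
exists (\col_i (a i 0 +i* b i 0)), (\col_i (c i 0 +i* d i 0)).
rewrite !re_gramE.
have reE (u v : 'cV[R]_M) : map_mx (@complex.Re R) (\col_i (u i 0 +i* v i 0)) = u.
  by apply/matrixP => i j; rewrite !mxE (ord1 j).
have imE (u v : 'cV[R]_M) : map_mx (@complex.Im R) (\col_i (u i 0 +i* v i 0)) = v.
  by apply/matrixP => i j; rewrite !mxE (ord1 j).
rewrite !reE !imE; move: Q40; rewrite /Q4 /Q3 /Q2 /Q1.
move: (a *m a^T) (b *m b^T) (c *m c^T) (d *m d^T) => A B C D E.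
apply/matrixP => i j; have := congr1 (fun X : 'M[R]_M => X i j) E.
by rewrite !mxE; lra.
Qed.

(** A three-dimensional space contains a nonzero vector on which the two
    positive squares of the difference vanish. *)
Lemma gram_difference_not_positive Q (V : 'M[R]_(3, M)) : gram_difference Q ->
  exists2 u : 'rV[R]_3, u != 0 & (u *m (V *m Q *m V^T) *m u^T) 0 0 <= 0.
Proof.
case=> x [y ->].
pose a := map_mx (@complex.Re R) x; pose b := map_mx (@complex.Im R) x.
pose c := map_mx (@complex.Re R) y; pose d := map_mx (@complex.Im R) y.
have [u u0 uker] : exists2 u : 'rV[R]_3, u != 0 & u *m (V *m row_mx a b) = 0.
  have : kermx (V *m row_mx a b) != 0.
    rewrite kermx_eq0 /row_free; apply/eqP => r3.
    by have := rank_leq_col (V *m row_mx a b); rewrite r3.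
  by case/rowV0Pn => u /sub_kermxP uV u0; exists u.
exists u => //.
have [ua ub] : u *m V *m a = 0 /\ u *m V *m b = 0.
  move: uker; rewrite mulmxA mul_mx_row => /eqP.
  by rewrite -[0 in X in X -> _](@row_mx0 _ 1 1 1) => /eqP/eq_row_mx[].
have sq (e : 'cV[R]_M) : (u *m V *m (e *m e^T) *m (V^T *m u^T)) 0 0 = ((u *m V *m e) 0 0) ^+ 2.
  rewrite -trmx_mul mulmxA -mulmxA -trmx_mul mxE big_ord1 expr2.
  by rewrite [in X in _ * X]mxE.
rewrite !mulmxA -mulmxA !re_gramE -/a -/b -/c -/d.
rewrite mulmxBr mulmxBl !mulmxDr !mulmxDl.
have D (X Y : 'M[R]_1) : (X + Y) 0 0 = X 0 0 + Y 0 0 by rewrite mxE.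
have B (X Y : 'M[R]_1) : (X - Y) 0 0 = X 0 0 - Y 0 0 by rewrite !mxE.
rewrite B !D !sq ua ub mxE expr0n /= addr0 sub0r oppr_le0.
by rewrite addr_ge0// sqr_ge0.
Qed.

(** Diagonal dominance: an error of 1/4 in each of the 9 entries costs at most
    3/4 of |u|^2, as the sum of all |u_i u_j| is at most 3 |u|^2. *)
Lemma near_identity_positive (G : 'M[R]_3) (u : 'rV[R]_3) :
  (forall i j, `|G i j - (i == j)%:R| <= 4^-1) -> u != 0 -> 0 < (u *m G *m u^T) 0 0.
Proof.
move=> Gid u0.
have uGu : (u *m G *m u^T) 0 0 = \sum_i \sum_j G j i * u 0 j * u 0 i.
  rewrite mxE; apply: eq_bigr => i _; rewrite !mxE mulr_suml.
  by apply: eq_bigr => j _; rewrite [u 0 j * _]mulrC.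
have u2 : 0 < \sum_i u 0 i ^+ 2.
  have [i ui] : exists i, u 0 i != 0.
    by have /matrix0Pn[i [j uij]] := u0; exists j; rewrite (ord1 i) in uij.
  rewrite (bigD1 i)//= ltr_wpDr ?sumr_ge0// => [j _|]; first exact: sqr_ge0.
  by rewrite exprn_even_gt0.
rewrite uGu.
have bnd i j : (i == j)%:R * u 0 j * u 0 i - 8^-1 * (u 0 j ^+ 2 + u 0 i ^+ 2) <=
    G j i * u 0 j * u 0 i.
  have := Gid j i; rewrite ler_norml eq_sym => /andP[g1 g2].
  set z : R := (i == j)%:R in g1 g2 *; set p := u 0 j; set q := u 0 i; set g := G j i in g1 g2 *.
  (* h1 + h2 is four times the claim *)
  have h1 : 0 <= (g - z + 4^-1) * (p + q) ^+ 2 by rewrite mulr_ge0 ?sqr_ge0//; lra.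
  have h2 : 0 <= (4^-1 - (g - z)) * (p - q) ^+ 2 by rewrite mulr_ge0 ?sqr_ge0//; lra.
  by move: h1 h2; rewrite !expr2; nra.
apply: (@lt_le_trans _ _ (\sum_i \sum_j
    ((i == j)%:R * u 0 j * u 0 i - 8^-1 * (u 0 j ^+ 2 + u 0 i ^+ 2)))).
  move: u2; rewrite !big_ord_recl !big_ord0 /= !(mulr0n, mulr1n) !expr2; lra.
by apply: ler_sum => i _; apply: ler_sum => j _.
Qed.

End Signature.

(** * Openness and conclusion *)

Section Openness.
Variables (R : realType) (M N : nat).

(** An inner product on a three-dimensional space remains positive there under
    small perturbations. *)
Lemma not_gram_difference_near (T : topologicalType) (t0 : T) (f : T -> 'M[R]_M)
    (V : 'M[R]_(3, M)) :
  (forall i j, {for t0, continuous (fun t => f t i j)}) ->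
  V *m f t0 *m V^T = 1%:M -> \forall t \near t0, ~ gram_difference (f t).
Proof.
move=> fcont V1; pose G t := V *m f t *m V^T.
have GE t i j : G t i j = \sum_k (\sum_l V i l * f t l k) * V j k.
  by rewrite mxE; apply: eq_bigr => k _; rewrite !mxE.
have Gcont i j : {for t0, continuous (fun t => G t i j)}.
  rewrite (_ : (fun t => G t i j) =
    (fun t => \sum_k (\sum_l V i l * f t l k) * V j k)); last exact/funext.
  apply: cvg_big => [|k _]; first exact: add_continuous.
  apply: cvgM; last exact: cvg_cst.
  apply: cvg_big => [|l _]; first exact: add_continuous.
  by apply: cvgM; [exact: cvg_cst|exact: fcont].
have Gnear : \forall t \near t0, forall p : 'I_3 * 'I_3,
    `|G t p.1 p.2 - (p.1 == p.2)%:R| <= 4^-1.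
  apply: filter_forall => -[i j] /=.
  have /cvgr_dist_le/(_ 4^-1) := Gcont i j.
  rewrite invr_gt0 ltr0n => /(_ isT); apply: filterS => t.
  by rewrite distrC [G t0]V1 [1%:M i j]mxE.
apply: filterS Gnear => t Gt /(gram_difference_not_positive V)[u u0].
rewrite leNgt => /negP; apply; apply: near_identity_positive u0 => i j.
exact: (Gt (i, j)).
Qed.

Lemma gram_differenceN (Q : 'M[R]_M) : gram_difference Q -> gram_difference (- Q).
Proof. by case=> x [y ->]; exists y, x; rewrite opprB. Qed.

Lemma gram_differenceZ (c : R) (Q : 'M[R]_M) : 0 <= c ->
  gram_difference Q -> gram_difference (c *: Q).
Proof.
move=> c0 [x [y ->]].
exists ((Num.sqrt c)%:C *: x), ((Num.sqrt c)%:C *: y).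
have gZ (z : 'cV[R[i]]_M) : re_gram ((Num.sqrt c)%:C *: z) = c *: re_gram z.
  apply/matrixP => i j; rewrite !mxE -[in RHS](sqr_sqrtr c0).
  by case: (z i 0) => a b; case: (z j 0) => d e /=; ring.
by rewrite !gZ scalerBr.
Qed.

Lemma gram_difference_sym (Q : 'M[R]_M) : gram_difference Q -> Q^T = Q.
Proof. by case=> x [y ->]; rewrite linearB /= !re_gram_sym. Qed.

Let vform (z : 'rV[R]_(M * M) * 'M[R]_(M, N)) n := qform (vec_mx z.1) (z.2^~ n).

Let vform_continuous n : continuous (fun z => vform z n).
Proof.
have c1 i j : continuous (fun z : 'rV[R]_(M * M) * 'M[R]_(M, N) => vec_mx z.1 i j).
  move=> z; rewrite (_ : (fun z => _) =
    (fun q : 'rV[R]_(M * M) => q 0 (mxvec_index i j)) \o fst).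
    by apply: continuous_comp; [exact: cvg_fst|exact: coord_continuous].
  by apply/funext => y; rewrite /= mxE.
have c2 i : continuous (fun z : 'rV[R]_(M * M) * 'M[R]_(M, N) => z.2 i n).
  move=> z; apply: (@continuous_comp _ _ _ snd (fun P : 'M[R]_(M, N) => P i n)).
    exact: cvg_snd.
  exact: coord_continuous.
apply: continuous_big => [|i _ ]; first exact: add_continuous.
apply: continuous_big => [|j _ z]; first exact: add_continuous.
exact: continuousM (continuousM (c1 i j z) (c2 i z)) (c2 j z).
Qed.

(** The condition is that no form q of norm 1 is bad for Phi.  By compactness of
    the sphere it is enough that being good is open in the pair (q, Phi): either
    q is a difference, and then it does not vanish at some column, or q is not
    a difference, and neither are its neighbours. *)
Lemma open_conj_phase_retrievable :
  open [set Phi : 'M[R]_(M, N) | conj_phase_retrievable (complex_columns Phi)].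
Proof.
pose bad (Phi : 'M[R]_(M, N)) (q : 'rV[R]_(M * M)) :=
  gram_difference (vec_mx q) /\ forall n, vform (q, Phi) n = 0.
pose K := [set q : 'rV[R]_(M * M) | `|q| = 1].
have Kcompact : compact K.
  apply: bounded_closed_compact.
    exists 1; split=> [|r r1 q /= ->]; [exact: num_real|exact: ltW].
  rewrite /K -[X in closed X]/((fun q : 'rV[R]_(M * M) => `|q|) @^-1` [set 1]).
  by apply: closed_comp => [q _|]; [exact: norm_continuous|exact: closed_eq].
rewrite openE => Phi /conj_phase_retrievableP PR.
have step q : K q -> \forall q' \near q & Phi' \near Phi, ~ bad Phi' q'.
  move=> Kq; have q0 : q != 0 by rewrite -normr_gt0 Kq.
  have [gd|ngd] := pselect (gram_difference (vec_mx q : 'M[R]_M)).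
    have [n fn] : exists n, vform (q, Phi) n != 0.
      apply: contrapT => none; move/eqP: q0; apply.
      case: gd => x [y qE]; rewrite -[q]vec_mxK qE (PR x y) ?subrr ?linear0//.
      move=> n; rewrite -qE; apply/eqP; apply: contrapT => /negP vn.
      by apply: none; exists n.
    have : \forall z \near (q, Phi), vform z n != 0.
      exact: cvgr_neq0 (@vform_continuous n (q, Phi)) fn.
    apply: filterS => -[q' Phi'] /= ne [_ z0].
    by move: ne; rewrite z0 eqxx.
  have vcont i j : {for q, continuous (fun q : 'rV[R]_(M * M) => vec_mx q i j)}.
    rewrite (_ : (fun q => _) = (fun q : 'rV[R]_(M * M) => q 0 (mxvec_index i j))).
      exact: coord_continuous.
    by apply/funext => y; rewrite mxE.
  have [U Uq Ungd] : exists2 U, nbhs q U & forall q', U q' -> ~ gram_difference (vec_mx q').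
    have [sym|nsym] := pselect ((vec_mx q)^T = vec_mx q :> 'M[R]_M); last first.
      have [i [j ij]] : exists i j, vec_mx q i j - vec_mx q j i != 0.
        apply: contrapT => none; apply: nsym; apply/matrixP => i j; rewrite mxE.
        apply/eqP; rewrite -subr_eq0; apply: contrapT => /negP ij.
        by apply: none; exists j, i.
      eexists; first exact: cvgr_neq0 (continuousB (vcont i j) (vcont j i)) ij.
      move=> q' + /gram_difference_sym sym'.
      have := congr1 (fun X : 'M[R]_M => X i j) sym'; rewrite [LHS]mxE => qji.
      by rewrite -[_ != 0]/(vec_mx q' i j - vec_mx q' j i != 0) qji subrr eqxx.
    have [[V VQ]|np] := pselect (represents_identity 3 (vec_mx q)).
      eexists; first exact: (not_gram_difference_near vcont VQ).
      by [].
    have [[V VQ]|nn] := pselect (represents_identity 3 (- vec_mx q)).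
      have vNcont i j : {for q, continuous (fun q : 'rV[R]_(M * M) => (- vec_mx q) i j)}.
        rewrite (_ : (fun q => _) = (fun q : 'rV[R]_(M * M) => - vec_mx q i j)).
          exact: continuousN (vcont i j).
        by apply/funext => y; rewrite mxE.
      eexists; first exact: (not_gram_difference_near vNcont VQ).
      by move=> q' + /gram_differenceN.
    by case: ngd; exact: gram_differenceP.
  exists (U, setT) => //=; first by split=> //; exact: filterT.
  by move=> -[q' Phi'] /= [Uq' _] [/(Ungd _ Uq')].
have Knear := (compact_near_coveringP K).1 Kcompact _ (nbhs Phi) (fun Phi' q' => ~ bad Phi' q')
  (nbhs_filter Phi) step.
suff : \forall Phi' \near Phi, conj_phase_retrievable (complex_columns Phi') by [].
apply: filterS Knear => Phi' KPhi'; apply/conj_phase_retrievableP => x y xy.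
apply/eqP; rewrite -subr_eq0; apply: contrapT => /negP D0.
set D := _ - _ in xy D0.
have vD0 : 0 < `|mxvec D| by rewrite normr_gt0 mxvec_eq0.
pose q := `|mxvec D|^-1 *: mxvec D.
have Kq : K q.
  by rewrite /K /= normrZ normfV normr_id mulVf// gt_eqF.
apply: (KPhi' q Kq); rewrite /bad /vform /= /q linearZ /= mxvecK; split.
  by apply: gram_differenceZ; [rewrite invr_ge0 ltW|exists x, y].
move=> n; rewrite /qform; transitivity (`|mxvec D|^-1 * qform D (Phi'^~ n)).
  rewrite mulr_sumr; apply: eq_bigr => i _; rewrite mulr_sumr.
  by apply: eq_bigr => j _; rewrite mxE !mulrA.
by rewrite xy mulr0.
Qed.

End Openness.

Theorem theorem2p5 (R : realType) (M N : nat)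
    (hM : (4 <= M)%N) (hN : (4 * M - 6 <= N)%N) :
  generic_frame
    (fun Phi : 'M[R]_(M, N) => conj_phase_retrievable (complex_columns Phi)).
Proof.
rewrite /generic_frame /=; set Y := [set _ | _].
have YE : Y = [set Phi : 'M[R]_(M, N) | conj_phase_retrievable (complex_columns Phi)].
  apply/seteqP; split=> Phi /= => [[]//|PR].
  by split=> //; exact: conj_phase_retrievable_rank.
have indepY : [set Phi : 'M[R]_(M, N) | alg_indep [::] (mx_entries Phi)] `<=` Y.
  by rewrite YE => Phi; exact: indep_conj_phase_retrievable.
split.
- by rewrite YE; exact: open_conj_phase_retrievable.
- move=> O O0 Oopen; have [Phi [OPhi /indepY YPhi]] := dense_alg_indep O0 Oopen.
  by exists Phi.
- have i0 : 'I_M by exists 0%N; apply: leq_trans hM.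
  have j0 : 'I_N by exists 0%N; apply: leq_trans hN; lia.
  apply: (mx_lebesgue_sub _ (mx_lebesgue_dependent R i0 j0)).
  by move=> Phi YPhi; apply/negP => /indepY.
Qed.
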